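(* Let $d,n$ be positive integers. Let $H\subset \mathcal{P}_n^{(d)}$ be a commutative subgroup of the $n$-qudit Pauli group without non-trivial scalars (i.e. $H\cap\{\zeta^a : a\in\mathbb{Z}\}=\{I\}$) such that $H$ is a free $\mathbb{Z}/d\mathbb{Z}$-module of rank $k$ (i.e. $H\simeq(\mathbb{Z}/d\mathbb{Z})^k$ as a group, $k\in\mathbb{Z}_{\geq 0}$). Then $k\leq n$, and there are a unitary isomorphism $V^H\simeq(\mathbb{C}^d)^{\otimes (n-k)}$ and an isomorphism of groups $N(H)/H\simeq \mathcal{P}^{(d)}_{n-k}$ such that the action of $N(H)/H$ on $V^H$ is identified with the action of $\mathcal{P}^{(d)}_{n-k}$ on $(\mathbb{C}^d)^{\otimes (n-k)}$.
   Context: Set $\bar d=d$ if $d$ is odd and $\bar d=2d$ if $d$ is even. Fix a primitive $\bar d$-th root of unity $\zeta\in\mathbb{C}$ and set $\xi=\zeta^2$, a primitive $d$-th root of unity. The space $\mathbb{C}^d$ has an orthonormal basis $\{v_i : i\in\mathbb{Z}/d\mathbb{Z}\}$ and operators $X(v_i)=v_{i+1}$, $Z(v_i)=\xi^i v_i$. Let $V=(\mathbb{C}^d)^{\otimes n}$ with the induced hermitian scalar product. For $r\in\{1,\dots,n\}$, $X_r$ and $Z_r$ denote the operators $X$ and $Z$ acting on the $r$-th tensor factor (identity on the others). The Pauli group $\mathcal{P}_n=\mathcal{P}_n^{(d)}\subset GL(V)$ is the subgroup generated by $X_r,Z_r$ ($1\leq r\leq n$) and by the operator of multiplication by $\zeta$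 (also denoted $\zeta$); $\mathcal{P}_0^{(d)}$ is the group generated by the scalar $\zeta$ acting on $\mathbb{C}=(\mathbb{C}^d)^{\otimes 0}$. For a subgroup $H\subset\mathcal{P}_n$, $V^H=\{v\in V : h(v)=v\ \forall h\in H\}$, and $N(H)$ is the normaliser of $H$ in $\mathcal{P}_n$; $N(H)$ preserves $V^H$ and $H$ acts trivially on it, so $N(H)/H$ acts on $V^H$.
   Formalization: For d = 1 the rank k is not well defined (the trivial group is isomorphic to (Z/1)^k for every k), so ''k ≤ n'' fails literally when k > n; the formal theorem assumes k ≤ n in the case d = 1 only. *)

(* Defs.v *)
From HB Require Import structures.
From mathcomp Require Import all_boot all_order all_algebra all_fingroup.
From mathcomp Require Import all_solvable.
From mathcomp Require Import boolp reals complex.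

Set Implicit Arguments.
Unset Strict Implicit.
Unset Printing Implicit Defensive.

Import Order.TTheory GRing.Theory Num.Theory.

Local Open Scope ring_scope.

Definition dbar (d : nat) : nat := if odd d then d else d.*2.

(* (C^d)^{\otimes n} as the space of coordinate functions on multi-indices: *)
(* v j is the coefficient of v_{j 0} \otimes ... \otimes v_{j (n-1)}.       *)
(* [ptens] and [onfactor_ptens] below tie this model to pure tensors.       *)
Notation qudits C d n := {ffun {ffun 'I_n -> 'I_d} -> C^o}.

Section Qudits.

Variables (C : numClosedFieldType) (d n : nat).

Local Notation V := (qudits C d n).

Definition ptens (u : 'I_n -> 'cV[C]_d) : V :=
  [ffun j : {ffun 'I_n -> 'I_d} => \prod_r u r (j r) 0].

Definition hdot (v w : V) : C := \sum_j v j * (w j)^*.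

Lemma hdot_ptens (u w : 'I_n -> 'cV[C]_d) :
  hdot (ptens u) (ptens w) = \prod_r \sum_i u r i 0 * (w r i 0)^*.
Proof.
rewrite bigA_distr_bigA /hdot; apply: eq_bigr => j _.
by rewrite !ffunE rmorph_prod -big_split.
Qed.

Definition upd (j : {ffun 'I_n -> 'I_d}) (r : 'I_n) (i : 'I_d) :
    {ffun 'I_n -> 'I_d} :=
  [ffun s => if s == r then i else j s].

Definition onfactor_fun (r : 'I_n) (A : 'M[C]_d) (v : V) : V :=
  [ffun j : {ffun 'I_n -> 'I_d} => \sum_i A (j r) i * v (upd j r i)].

(* A acting on the r-th tensor factor, identity on the others. *)
Definition onfactor (r : 'I_n) (A : 'M[C]_d) : 'End(V) :=
  linfun (onfactor_fun r A).

Lemma onfactorE r A v : onfactor r A v = onfactor_fun r A v.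
Proof.
have lin : linear (onfactor_fun r A).
  move=> a u w; apply/ffunP=> j; rewrite !ffunE scaler_sumr -big_split.
  apply: eq_bigr => i _; rewrite !ffunE mulrDr; congr (_ + _).
  by rewrite /GRing.scale /= mulrCA.
pose F : {linear V -> V} := HB.pack (onfactor_fun r A) (GRing.isLinear.Build _ _ _ _ _ lin).
exact: (lfunE F v).
Qed.

Lemma onfactor_ptens r A u :
  onfactor r A (ptens u) = ptens (fun s => if s == r then A *m u s else u s).
Proof.
rewrite onfactorE; apply/ffunP => j; rewrite !ffunE.
rewrite [RHS](bigD1 r) //= eqxx mxE big_distrl /=; apply: eq_bigr => i _.
rewrite ffunE (bigD1 r) //= ffunE eqxx mulrA; congr (_ * _).
by apply: eq_bigr => s /negPf sr; rewrite ffunE sr.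
Qed.

End Qudits.

Section Paulis.

Variables (C : numClosedFieldType) (d : nat) (zeta : C).

(* Matrices act on columns: v_i is the i-th basis column, [ordS] is the     *)
(* successor in Z/d, and i : 'I_d is the representative in [0, d[.          *)
Definition Xmx : 'M[C]_d := \matrix_(j, i) (j == ordS i)%:R.
Definition Zmx : 'M[C]_d := diag_mx (\row_i (zeta ^+ 2) ^+ i).

(* The subgroup of GL(V) generated by zeta, X_r, Z_r; all members are       *)
(* bijective ([pauli_lker0]), so [inv_lfun] is the actual inverse on them.  *)
Inductive pauli_gen (n : nat) : 'End(qudits C d n) -> Prop :=
| pauli_gen1 : pauli_gen \1%VF
| pauli_gen_zeta : pauli_gen (zeta *: \1)%VF
| pauli_genX (r : 'I_n) : pauli_gen (onfactor r Xmx)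
| pauli_genZ (r : 'I_n) : pauli_gen (onfactor r Zmx)
| pauli_genM f g : pauli_gen f -> pauli_gen g -> pauli_gen (f \o g)%VF
| pauli_genV f : pauli_gen f -> pauli_gen (f^-1)%VF.

Section Bijectivity.

Hypothesis zetaP : (dbar d).-primitive_root zeta.
Variable n : nat.

Local Notation V := (qudits C d n).
Local Notation I := {ffun 'I_n -> 'I_d}.

Definition monomial_fun (t : {ffun I -> 'I_(dbar d)} * {perm I}) (v : V) : V :=
  [ffun j : I => zeta ^+ t.1 j * v (t.2 j)].

Definition monomial t : 'End(V) := linfun (monomial_fun t).

Lemma monomialE t v : monomial t v = monomial_fun t v.
Proof.
have lin : linear (monomial_fun t).
  move=> a u w; apply/ffunP=> j; rewrite !ffunE mulrDr; congr (_ + _).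
  by rewrite /GRing.scale /= mulrCA.
pose F : {linear V -> V} :=
  HB.pack (monomial_fun t) (GRing.isLinear.Build _ _ _ _ _ lin).
exact: (lfunE F v).
Qed.

Definition mon_exp (e : I -> nat) : {ffun I -> 'I_(dbar d)} :=
  [ffun j => Ordinal (ltn_pmod (e j) (prim_order_gt0 zetaP))].

Lemma monomial_expE e s v j :
  monomial (mon_exp e, s) v j = zeta ^+ e j * v (s j).
Proof. by rewrite monomialE !ffunE /= prim_expr_mod. Qed.

Lemma monomial_comp t u : exists w, (monomial t \o monomial u)%VF = monomial w.
Proof.
exists (mon_exp (fun j => t.1 j + u.1 (t.2 j))%N, (t.2 * u.2)%g).
apply/lfunP=> v; apply/ffunP=> j.
by rewrite monomial_expE lfunE /= !monomialE !ffunE mulrA exprD permM.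
Qed.

Lemma monomial_inj t : exists2 w, (monomial w \o monomial t)%VF = \1%VF
  & (monomial t \o monomial w)%VF = \1%VF.
Proof.
have dgt0 := prim_order_gt0 zetaP.
exists (mon_exp (fun j => dbar d - t.1 ((t.2)^-1%g j))%N, (t.2)^-1%g).
  apply/lfunP=> v; apply/ffunP=> j.
  rewrite lfunE /= monomial_expE !monomialE !ffunE permKV id_lfunE mulrA -exprD.
  by rewrite subnK ?prim_expr_order ?mul1r // ltnW.
apply/lfunP=> v; apply/ffunP=> j.
rewrite lfunE /= monomialE ffunE monomial_expE /= permK id_lfunE mulrA -exprD.
by rewrite subnKC ?prim_expr_order ?mul1r // ltnW.
Qed.

Lemma monomial_lker0 t : lker (monomial t) == 0%VS.
Proof.
have [w wt _] := monomial_inj t.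
apply/lker0P => u v /(congr1 (monomial w)).
by rewrite -![monomial w _]comp_lfunE wt !id_lfunE.
Qed.

Lemma ord_pred_inj m : injective (@ord_pred m).
Proof. exact: can_inj (@ord_predK m). Qed.

Lemma pauli_monomial (f : 'End(V)) : pauli_gen f -> exists t, f = monomial t.
Proof.
elim=> {f}.
- exists (mon_exp (fun=> 0%N), 1%g); apply/lfunP=> v; apply/ffunP=> j.
  by rewrite monomial_expE perm1 expr0 mul1r id_lfunE.
- exists (mon_exp (fun=> 1%N), 1%g); apply/lfunP=> v; apply/ffunP=> j.
  by rewrite monomial_expE perm1 expr1 scale_lfunE id_lfunE ffunE.
- move=> r; pose s (j : I) : I := upd j r (ord_pred (j r)).
  have s_inj : injective s.
    move=> j k jk; apply/ffunP=> i; have := congr1 (fun x : I => x i) jk.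
    by rewrite !ffunE; case: eqP => [->|//]; apply: ord_pred_inj.
  exists (mon_exp (fun=> 0%N), perm s_inj); apply/lfunP=> v; apply/ffunP=> j.
  rewrite monomial_expE expr0 mul1r permE onfactorE ffunE.
  rewrite (bigD1 (ord_pred (j r))) //= !mxE ord_predK eqxx mul1r big1 ?addr0 //.
  move=> i /negPf ij; rewrite mxE; case: eqP => [jE|_]; last by rewrite mul0r.
  by move: ij; rewrite jE ordSK eqxx.
- move=> r; exists (mon_exp (fun j => 2 * j r)%N, 1%g).
  apply/lfunP=> v; apply/ffunP=> j.
  rewrite monomial_expE onfactorE ffunE perm1 (bigD1 (j r)) //= !mxE eqxx.
  rewrite mulr1n -exprM (_ : upd _ _ _ = j) ?big1 ?addr0 //; last first.
    by apply/ffunP=> i; rewrite ffunE; case: eqP => // ->.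
  by move=> i /negPf ij; rewrite !mxE eq_sym ij mulr0n mul0r.
- by move=> f g _ [t ->] _ [u ->]; apply: monomial_comp.
move=> f _ [t ->]; have [w wt _] := monomial_inj t; exists w.
by rewrite -[RHS]comp_lfun1r -(lker0_compfV (monomial_lker0 t)) comp_lfunA wt
           comp_lfun1l.
Qed.

Lemma pauli_lker0 (f : 'End(V)) : pauli_gen f -> lker f == 0%VS.
Proof. by move=> /pauli_monomial[t ->]; apply: monomial_lker0. Qed.

End Bijectivity.

End Paulis.

(* The group P_n^(d).  The proof zetaP is a parameter because finiteness    *)
(* and invertibility depend on zeta being a root of unity.                  *)
Record pauli (C : numClosedFieldType) (d : nat) (zeta : C)
    (zetaP : (dbar d).-primitive_root zeta) (n : nat) : Type := Pauli {
  pauli_op :> 'End(qudits C d n);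
  pauli_opP : `[< pauli_gen zeta pauli_op >] }.

Section PauliGroup.

Variables (C : numClosedFieldType) (d : nat) (zeta : C).
Variables (zetaP : (dbar d).-primitive_root zeta) (n : nat).

Local Notation P := (pauli zetaP n).

HB.instance Definition _ := [isSub for @pauli_op C d zeta zetaP n].

Lemma pauli_code_ex (f : P) : exists t, pauli_op f == monomial zeta t.
Proof.
by have [t ->] := pauli_monomial zetaP (asboolW (pauli_opP f)); exists t.
Qed.

Definition pauli_code (f : P) := xchoose (pauli_code_ex f).
Definition pauli_decode t : option P := insub (monomial zeta t).

Lemma pauli_codeK : pcancel pauli_code pauli_decode.
Proof.
move=> f; rewrite /pauli_decode /pauli_code.
by rewrite -(eqP (xchooseP (pauli_code_ex f))) valK.
Qed.

HB.instance Definition _ := Finite.copy P (pcan_type pauli_codeK).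

Definition pauli_one : P := Pauli zetaP (asboolT (@pauli_gen1 C d zeta n)).
Definition pauli_mul (f g : P) : P :=
  Pauli zetaP
    (asboolT (pauli_genM (asboolW (pauli_opP f)) (asboolW (pauli_opP g)))).
Definition pauli_inv (f : P) : P :=
  Pauli zetaP (asboolT (pauli_genV (asboolW (pauli_opP f)))).

Lemma pauli_mulA : associative pauli_mul.
Proof. by move=> f g h; apply: val_inj; apply: comp_lfunA. Qed.
Lemma pauli_mul1 : left_id pauli_one pauli_mul.
Proof. by move=> f; apply: val_inj; apply: comp_lfun1l. Qed.
Lemma pauli_mulV : left_inverse pauli_one pauli_inv pauli_mul.
Proof.
move=> f; apply: val_inj; apply: lker0_compVf.
exact: (pauli_lker0 zetaP (asboolW (pauli_opP f))).
Qed.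

HB.instance Definition _ :=
  Finite_isGroup.Build P pauli_mulA pauli_mul1 pauli_mulV.

Definition pauli_zeta : P := Pauli zetaP (asboolT (@pauli_gen_zeta C d zeta n)).

(* V^H *)
Definition fixed_by (H : {set P}) : {vspace qudits C d n} :=
  (\bigcap_(h in H) fixedSpace (pauli_op h))%VS.

Lemma fixed_byP (H : {set P}) v :
  reflect (forall h, h \in H -> pauli_op h v = v) (v \in fixed_by H).
Proof.
apply: (iffP subv_bigcapP) => vH h hH; have := vH h hH.
  by rewrite -memvE => /fixedSpaceP.
by rewrite -memvE => /fixedSpaceP.
Qed.

Variable H : {group P}.

(* The action of an element of N(H)/H on V^H, computed on a representative; *)
(* [quo_actE] shows that the choice is immaterial and that no truncation by *)
(* the projection [vsproj] occurs.                                          *)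
Definition quo_act (x : coset_of H) : 'End(subvs_of (fixed_by H)) :=
  linfun (vsproj (fixed_by H) \o pauli_op (repr x) \o vsval).

Lemma norm_fixed_by g v :
  g \in 'N(H)%g -> v \in fixed_by H -> pauli_op g v \in fixed_by H.
Proof.
move=> gN /fixed_byP vH; apply/fixed_byP => h hH.
rewrite -comp_lfunE -[(_ \o _)%VF]/(pauli_op (h * g)%g).
rewrite (_ : (h * g = g * (h ^ g))%g); last by rewrite conjgC.
by rewrite comp_lfunE vH ?memJ_norm.
Qed.

Lemma quo_actE g v :
  g \in 'N(H)%g -> vsval (quo_act (coset H g) v) = pauli_op g (vsval v).
Proof.
move=> gN; rewrite lfunE /=.
have [h hH ->] : exists2 h, h \in H & repr (coset H g) = (g * h)%g.
  have := mem_repr_coset (coset H g).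
  rewrite val_coset // norm_rlcoset // => /lcosetP[h hH ->].
  by exists h.
have -> : pauli_op (g * h)%g (vsval v) = pauli_op g (vsval v).
  by rewrite comp_lfunE (fixed_byP _ _ (subvsP v)).
by rewrite vsprojK // norm_fixed_by // subvsP.
Qed.

End PauliGroup.

(* Main.v *)
(** Modulo scalars, P_n is the free symplectic module (Z/d)^2n, the form being
    the commutator.  A basis h_i (i < k) of H is first extended to a Lagrangian
    basis h_0, ..., h_(n-1), and then to a symplectic basis by elements y_i of
    order d with [h_i, y_j] = xi^(i == j).  As Z/d is not a field, the extension
    step rests on a count: if the commutant of k hyperbolic pairs had exponent
    e < d modulo scalars, then (d/e)^2n <= (d/e)^2k.  Let w be a unit vector
    fixed by all h_i.  The vectors y^j w are joint eigenvectors of the h_i with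
    distinct eigenvalues, hence orthonormal, and those with j_i = 0 for i < k
    span V^H.  Sending v_j to y^j w intertwines X_r, Z_r with y_(k+r), h_(k+r),
    which yields both the isometry and the isomorphism N(H)/H = P_(n-k). *)

From HB Require Import structures.
Require Import Defs.
From mathcomp Require Import all_boot all_order all_algebra all_fingroup.
From mathcomp Require Import all_solvable reals complex.
From mathcomp Require boolp.
Import GRing.Theory Num.Theory.

Set Implicit Arguments.
Unset Strict Implicit.
Unset Printing Implicit Defensive.

(** * Groups whose commutators are powers of a central element *)

(** The obstacle is that Z/d need not be a field: a non-zero value of the form cannot be divided
    out. Two facts about finite groups replace division. If no proper divisor of d kills all
    commutators of an element, then these fill the whole cyclic group <q>, by comparing orders. And
    a finite abelian group has an element whose order is its exponent, so the extension step only
    has to exclude an exponent smaller than d. The linear algebra stays inside the group, with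
    natural exponents and commutators instead of vectors, because the orders of lifts matter: XZ has
    d-th power xi^(d(d-1)/2) up to inversion, which is -1 for even d. This is why zeta has order 2d
    in that case: every d-th power is then the d-th power of a scalar, and each element can be
    rescaled to have d-th power 1. The absence of scalars in H enters twice: it keeps a basis of H
    independent modulo scalars, and it forces N(H) to centralise H. *)

Section CommutatorForm.

Local Open Scope group_scope.

Variables (gT : finGroupType) (z : gT) (d : nat).
Local Notation q := (z ^+ 2).

Hypothesis zC : forall x, commute z x.
Hypothesis comX : forall x y, [~ x, y] \in <[q]>.
Hypothesis order_q : #[q] = d.

Lemma comm_log_ex x y : exists i, [~ x, y] == q ^+ i.
Proof. by have /cycleP[i ->] := comX x y; exists i. Qed.

(** An arbitrary witness: only its class modulo [d] is meaningful. *)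
Definition comm_log x y : nat := xchoose (comm_log_ex x y).

Lemma comm_logE x y : [~ x, y] = q ^+ comm_log x y.
Proof. exact/eqP/(xchooseP (comm_log_ex x y)). Qed.

Lemma qC i x : commute x (q ^+ i).
Proof. exact/commuteX/commuteX/commute_sym/zC. Qed.

Lemma q_eq i j : (q ^+ i == q ^+ j) = (i == j %[mod d]).
Proof. by rewrite eq_expg_mod_order order_q. Qed.

Lemma q_eq1 i : (q ^+ i == 1) = (d %| i).
Proof. by rewrite -order_dvdn order_q. Qed.

Lemma d_gt0 : 0 < d.
Proof. by rewrite -order_q order_gt0. Qed.

Lemma comm_central (x y u : gT) : commute u [~ x, y].
Proof. by rewrite comm_logE; apply: qC. Qed.

Lemma commMgc (x y t : gT) : [~ x * y, t] = [~ x, t] * [~ y, t].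
Proof. by rewrite commMgJ (conjgE _ y) -(comm_central x t y) mulKg. Qed.

Lemma commgMc (x y t : gT) : [~ t, x * y] = [~ t, x] * [~ t, y].
Proof.
by rewrite commgMJ (conjgE _ y) -(comm_central t x y) mulKg comm_central.
Qed.

Lemma commXgc (x t : gT) i : [~ x ^+ i, t] = [~ x, t] ^+ i.
Proof. exact/commXg/comm_central. Qed.

Lemma commgXc (x t : gT) i : [~ t, x ^+ i] = [~ t, x] ^+ i.
Proof. exact/commgX/comm_central. Qed.

Lemma commVgc (x t : gT) : [~ x^-1, t] = [~ x, t]^-1.
Proof. exact/commVg/comm_central. Qed.

Lemma commgVc (x t : gT) : [~ t, x^-1] = [~ t, x]^-1.
Proof. exact/commgV/comm_central. Qed.

Definition prod_pow (I : finType) (s : I -> gT) (a : I -> nat) : gT :=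
  \prod_i s i ^+ a i.

(** The factors need not commute; since commutators are central, the form is still additive along
    the ordered product. *)
Lemma comm_prod_pow (I : finType) (s : I -> gT) a t (e : I -> nat) :
  (forall i, [~ s i, t] = q ^+ e i) ->
  [~ prod_pow s a, t] = q ^+ (\sum_i a i * e i)%N.
Proof.
move=> st; rewrite /prod_pow; elim/big_rec2: _ => [|i m x _ IH]; first exact: comm1g.
by rewrite commMgc commXgc st -expgM [(e i * _)%N]mulnC expgD IH.
Qed.

Lemma commg_prod_pow (I : finType) (s : I -> gT) a t (e : I -> nat) :
  (forall i, [~ t, s i] = q ^+ e i) ->
  [~ t, prod_pow s a] = q ^+ (\sum_i a i * e i)%N.
Proof.
move=> st; rewrite /prod_pow; elim/big_rec2: _ => [|i m x _ IH]; first exact: commg1.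
by rewrite commgMc commgXc st -expgM [(e i * _)%N]mulnC expgD IH.
Qed.

Lemma comm_prod_pow1 (I : finType) (s : I -> gT) a t :
  (forall i, [~ s i, t] = 1) -> [~ prod_pow s a, t] = 1.
Proof.
move=> st; rewrite (@comm_prod_pow _ _ _ _ (fun=> 0)) ?big1 // => i _.
exact: muln0.
Qed.

Lemma commg_prod_pow1 (I : finType) (s : I -> gT) a t :
  (forall i, [~ t, s i] = 1) -> [~ t, prod_pow s a] = 1.
Proof.
move=> st; rewrite (@commg_prod_pow _ _ _ _ (fun=> 0)) ?big1 // => i _.
exact: muln0.
Qed.

Lemma sum_delta (I : finType) (a : I -> nat) j :
  (\sum_i a i * (i == j))%N = a j.
Proof.
rewrite (bigD1 j) //= eqxx muln1 big1 ?addn0 // => i /negPf->.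
exact: muln0.
Qed.

(** * Dual families and counting *)

Definition dual (I : finType) (s t : I -> gT) :=
  forall i j, [~ s i, t j] = q ^+ (i == j).

Lemma comm_prod_pow_dual (I : finType) (s t : I -> gT) a j :
  dual s t -> [~ prod_pow s a, t j] = q ^+ a j.
Proof. by move=> st; rewrite (comm_prod_pow _ (st^~ j)) sum_delta. Qed.

Lemma commg_prod_pow_dual (I : finType) (s t : I -> gT) a j :
  dual s t -> [~ s j, prod_pow t a] = q ^+ a j.
Proof.
move=> st; rewrite (commg_prod_pow _ (st j)).
by under eq_bigr do rewrite eq_sym; rewrite sum_delta.
Qed.

(** For [e = 1], whatever commutes with [s] commutes with everything; larger [e] measures the
    failure of this. *)
Definition nondeg (I : finType) (s : I -> gT) e :=
  forall x, (forall i, [~ x, s i] = 1) -> forall u, [~ x, u] ^+ e = 1.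

(** Taking [e]-th powers in <q> retains the exponent modulo [f], which separates numbers below
    [f]. *)
Lemma q_pow_inj_mod (e f i j : nat) : (e * f)%N = d -> i < f -> j < f ->
  (q ^+ i * (q ^+ j)^-1) ^+ e = 1 -> i = j.
Proof.
move=> ef lif ljf.
have eg0: 0 < e by move: d_gt0; rewrite -ef muln_gt0 => /andP[].
have cq: commute (q ^+ i) (q ^+ j)^-1 by apply/commuteV/qC.
rewrite expgMn // expgVn => /eqP; rewrite -eq_mulgV1 -!(expgM q).
rewrite q_eq -ef ![(_ * e)%N]mulnC -!muln_modr !modn_small //.
by rewrite eqn_pmul2l // => /eqP.
Qed.

(* Taking coordinates modulo f with respect to s is injective on the exponents
   below f, since the commutant of s is killed by e = d / f. *)
Lemma comm_log_inj (J K : finType) (t t' : J -> gT) (s s' : K -> gT) e f :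
    (e * f)%N = d -> dual t t' -> dual s' s -> nondeg s e ->
  injective (fun a : {ffun J -> 'I_f} =>
               [ffun i => comm_log (prod_pow t (fun j => a j : nat)) (s i) %% f]%N).
Proof.
move=> ef tt' s's sK a b /ffunP ab; apply/ffunP => j; apply/val_inj.
apply: (q_pow_inj_mod ef) => //=.
set x := prod_pow t (fun j => a j : nat) * (prod_pow t (fun j => b j : nat))^-1.
have xs i : exists c, [~ x, s i] = q ^+ (f * c)%N.
  have := ab i; rewrite !ffunE => abi.
  suff /cycleP[c ->]: [~ x, s i] \in <[q ^+ f]> by exists c; rewrite expgM.
  rewrite /x commMgc commVgc !comm_logE (divn_eq (comm_log _ _) f) abi.
  rewrite [in X in _ * X^-1](divn_eq (comm_log (prod_pow t _) _) f).
  rewrite !expgD invMg mulgA mulgK ![(_ * f)%N]mulnC !expgM.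
  by rewrite groupM ?groupV ?mem_cycle.
(* The element [p] built next has the same coordinates against [s] as [x], so [y] lies in the
   commutant of [s] and [e] kills its commutators. It also kills those of [p], whose exponents are
   multiples of [f]. *)
have /fin_all_exists[c xc] := xs.
pose p := prod_pow s' (fun i => f * c i)%N; pose y := x * p^-1.
have ys i : [~ y, s i] = 1.
  by rewrite commMgc commVgc (comm_prod_pow_dual _ _ s's) xc mulgV.
have xE : x = y * p by rewrite mulgKV.
suff: [~ x, t' j] ^+ e = 1.
  by rewrite commMgc commVgc !(comm_prod_pow_dual _ _ tt').
rewrite xE commMgc expgMn; last exact: comm_central.
rewrite sK // mul1g (comm_prod_pow _ (fun i => comm_logE (s' i) (t' j))) -expgM.
apply/eqP; rewrite q_eq1 -{1}ef mulnC dvdn_pmul2r; last first.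
  by move: d_gt0; rewrite -ef muln_gt0 => /andP[].
by apply: dvdn_sum => i _; rewrite -mulnA dvdn_mulr.
Qed.

(** Pigeonhole. For [e = 1] it compares ranks over Z/d; in general it has content as soon as
    [f > 1]. *)
Lemma dual_card_le (J K : finType) (t t' : J -> gT) (s s' : K -> gT) e f :
    (e * f)%N = d -> dual t t' -> dual s' s -> nondeg s e ->
  (f ^ #|J| <= f ^ #|K|)%N.
Proof.
move=> ef tt' s's sK; have := comm_log_inj ef tt' s's sK.
have f_gt0 : 0 < f by move: d_gt0; rewrite -ef muln_gt0 => /andP[].
pose F (a : {ffun J -> 'I_f}) : {ffun K -> 'I_f} :=
  [ffun i => Ordinal (ltn_pmod (comm_log (prod_pow t (fun j => a j : nat)) (s i)) f_gt0)].
move=> Finj; have FI : injective F.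
  move=> a b /ffunP ab; apply: Finj; apply/ffunP=> i; rewrite !ffunE.
  by have := ab i; rewrite !ffunE => /(congr1 val).
by have := leq_card F FI; rewrite !card_ffun card_ord.
Qed.

(** With equal cardinalities the injection is onto, so some product of the [t j] has the coordinates
    of [x] against [s]; the quotient of the two commutes with [s], hence with everything. *)
Lemma dual_generate (J K : finType) (t t' : J -> gT) (s s' : K -> gT) x :
    #|J| = #|K| -> dual t t' -> dual s' s -> nondeg s 1 ->
  exists a : J -> nat, forall u, [~ x, u] = [~ prod_pow t a, u].
Proof.
move=> JK tt' s's sK; have := comm_log_inj (mul1n d) tt' s's sK.
pose F (a : {ffun J -> 'I_d}) : {ffun K -> 'I_d} :=
  [ffun i => Ordinal (ltn_pmod (comm_log (prod_pow t (fun j => a j : nat)) (s i)) d_gt0)].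
move=> Finj; have FI : injective F.
  move=> a b /ffunP ab; apply: Finj; apply/ffunP=> i; rewrite !ffunE.
  by have := ab i; rewrite !ffunE => /(congr1 val).
have /codomP[a /ffunP aE] : 
    [ffun i => Ordinal (ltn_pmod (comm_log x (s i)) d_gt0)] \in codom F.
  by apply: (inj_card_onto FI); rewrite !card_ffun JK.
exists (fun j => a j : nat) => u; apply/eqP.
rewrite eq_mulgV1 -commVgc -commMgc -[_ == 1]/(_ ^+ 1 == 1).
apply/eqP; apply: sK => i; rewrite commMgc commVgc !comm_logE; apply/eqP.
rewrite -eq_mulgV1 q_eq; apply/eqP.
by have := aE i; rewrite !ffunE => /(congr1 val).
Qed.

(* Linear independence over Z/d modulo the centre; exponents are naturals, so
   [i * d.-1] plays the part of [- i] below. *)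
Definition indep k (h : nat -> gT) := forall a : nat -> nat,
  (forall u, [~ prod_pow (fun i : 'I_k => h i) (fun i => a i), u] = 1) ->
  forall i, i < k -> d %| a i.

Lemma prod_powS k (h : nat -> gT) (a : nat -> nat) :
  prod_pow (fun i : 'I_k.+1 => h i) (fun i => a i) =
  prod_pow (fun i : 'I_k => h i) (fun i => a i) * h k ^+ a k.
Proof. by rewrite /prod_pow big_ord_recr. Qed.

(** The map u -> [h, u] is a homomorphism into <q>. The order of its image [B] kills all these
    commutators, so [d] divides it and [B] is all of <q>. *)
Lemma exists_commg_eq h :
  (forall b, (forall u, [~ h, u] ^+ b = 1) -> d %| b) ->
  exists u, [~ h, u] = q.
Proof.
move=> hb; pose B := [set [~ h, u] | u : gT].
have gB : group_set B.
  apply/group_setP; split; first by apply/imsetP; exists 1; rewrite ?commg1.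
  move=> _ _ /imsetP[u _ ->] /imsetP[v _ ->]; apply/imsetP.
  by exists (u * v); rewrite // commgMc.
have Bq : B :=: <[q]>.
  apply/eqP; rewrite eqEcard; apply/andP; split.
    by apply/subsetP=> _ /imsetP[u _ ->].
  rewrite [X in X <= _]order_q dvdn_leq ?(cardG_gt0 (Group gB)) //.
  by apply: hb => u; apply: (expg_cardG (_ : _ \in Group gB)); apply: imset_f.
by have := cycle_id q; rewrite -Bq => /imsetP[u _ ->]; exists u.
Qed.

Lemma q_expB i : q ^+ i * q ^+ (i * d.-1) = 1.
Proof.
rewrite -expgD -[X in (X + _)%N]muln1 -mulnDr add1n prednK ?d_gt0 //.
by apply/eqP; rewrite q_eq1 dvdn_mull.
Qed.

(* Gram-Schmidt: first make [h k] commute with the dual of the previous h's. *)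
Lemma exists_dual k h : indep k h -> exists y : nat -> gT,
  dual (fun i : 'I_k => h i) (fun i : 'I_k => y i).
Proof.
elim: k => [|k IH] hk; first by exists h; case.
have [] := IH.
  move=> a ha i ik; pose b j := if j < k then a j else 0.
  have := hk b; rewrite (prod_powS k h b) {2}/b ltnn mulg1.
  rewrite (_ : prod_pow _ _ = prod_pow (fun i : 'I_k => h i) (fun i => a i)).
    by move=> /(_ ha i (ltnW ik)); rewrite /b ik.
  by apply: eq_bigr => j _; rewrite /b ltn_ord.
move=> y hy.
pose c i := comm_log (h k) (y i).
pose p := prod_pow (fun i : 'I_k => h i) (fun i => c i * d.-1)%N.
pose h' := p * h k.
have h'y (i : 'I_k) : [~ h', y i] = 1.
  rewrite commMgc (@comm_prod_pow_dual _ _ _ _ i hy) comm_logE.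
  by rewrite (qC _ _) q_expB.
(* A power [b] killing the commutators of [h'] is a relation among the [h i] whose last coefficient
   is [b], so independence gives [d %| b]. *)
have [w h'w] : exists w, [~ h', w] = q.
  apply: exists_commg_eq => b hb.
  pose a i := if i < k then (c i * d.-1 * b)%N else b.
  have := hk a; rewrite (prod_powS k h a) {2}/a ltnn => /(_ _ k).
  rewrite /a ltnn; apply=> // u.
  rewrite -(hb u) /h' !commMgc commXgc.
  rewrite (expgMn _ (comm_central (h k) u [~ p, u])).
  congr (_ * _); rewrite /p !(comm_prod_pow _ (fun i : 'I_k => comm_logE _ u)).
  rewrite -(expgM q).
  congr (_ ^+ _); rewrite big_distrl; apply: eq_bigr => i _.
  by rewrite ltn_ord mulnAC.
pose w' := w * prod_pow (fun i : 'I_k => y i) (fun i => comm_log (h i) w * d.-1)%N.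
have hw' (i : 'I_k) : [~ h i, w'] = 1.
  by rewrite commgMc (@commg_prod_pow_dual _ _ _ _ i hy) comm_logE q_expB.
(* Neither correction matters here: [p] commutes with [w'], and [h'] commutes with every [y i]. *)
have hkw' : [~ h k, w'] = q.
  rewrite -h'w -(mul1g [~ h k, w']).
  rewrite -(@comm_prod_pow1 _ (fun i : 'I_k => h i) (fun i => c i * d.-1)%N w') //.
  by rewrite -commMgc commgMc [X in _ * X](commg_prod_pow1 _ h'y) mulg1.
pose y' i := if i < k then y i * w' ^+ (c i * d.-1) else w'.
exists y' => i j; rewrite /y'.
have [iE|ik] : i = ord_max \/ exists i' : 'I_k, i = widen_ord (leqnSn k) i'.
- case: (ltnP i k) => ik.
    by right; exists (Ordinal ik); apply: val_inj.
  by left; apply/val_inj/eqP; rewrite eqn_leq /= ik -ltnS ltn_ord.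
- rewrite iE /=; case: ltnP => jk.
    rewrite (_ : (ord_max == j) = false) ?expg0; last first.
      by apply/negbTE/eqP=> /(congr1 val) /= kj; rewrite -kj ltnn in jk.
    by rewrite commgMc commgXc hkw' comm_logE q_expB.
  rewrite hkw' (_ : ord_max == j) //.
  by apply/eqP/val_inj/eqP; rewrite eqn_leq /= jk -ltnS ltn_ord.
case: ik => i' ->; case: ltnP => jk /=.
  rewrite commgMc commgXc hw' expg1n mulg1.
  exact: (hy i' (Ordinal jk)).
rewrite hw' (_ : (_ == _) = false) //; apply/negbTE/eqP=> /(congr1 val) /= ij.
by rewrite -ij leqNgt ltn_ord in jk.
Qed.

(** Multiplying [y j] by products of the commuting [h i] keeps duality. The factor [i < j] charges
    the whole of [y_i, y_j] to the later element of each pair; a symmetric correction would have to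
    halve it, which fails for even [d]. *)
Lemma exists_commuting_dual k h :
    (forall i j, i < k -> j < k -> commute (h i) (h j)) -> indep k h ->
  exists2 y : nat -> gT, dual (fun i : 'I_k => h i) (fun i : 'I_k => y i)
    & forall i j, i < k -> j < k -> commute (y i) (y j).
Proof.
move=> hh /exists_dual[y hy].
have hh1 i j : i < k -> j < k -> [~ h i, h j] = 1.
  by move=> ik jk; apply/eqP/commgP/hh.
pose p j := prod_pow (fun i : 'I_k => h i) (fun i => (i < j) * comm_log (y i) (y j))%N.
exists (fun j => y j * p j).
  by move=> i j; rewrite commgMc hy commg_prod_pow1 ?mulg1 // => l; apply: hh1.
suff yy i j : i < j -> j < k -> commute (y i * p i) (y j * p j).
  move=> i j ik jk; case: (ltngtP i j) => [ij|ji|->//]; first exact: yy.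
  exact/commute_sym/yy.
move=> ij jk; have ik := ltn_trans ij jk; apply/commgP/eqP.
have yhE l m : l < k -> [~ p m, y l] = q ^+ ((l < m) * comm_log (y l) (y m)).
  by move=> lk; rewrite (@comm_prod_pow_dual _ _ _ _ (Ordinal lk) hy).
rewrite commMgc !commgMc yhE // [(j < i)]ltnNge (ltnW ij) mul0n mul1g.
rewrite -(invg_comm (p j)) yhE // ij mul1n comm_logE mulgV mul1g.
by apply: comm_prod_pow1 => l; apply: commg_prod_pow1 => m; apply: hh1.
Qed.

Hypothesis pow_d : forall x, x ^+ d \in <[z ^+ d]>.

(** By [pow_d], the d-th power of [x] is that of some scalar z^i, and the witness is -i modulo the
    order of [z]. *)
Lemma exists_scaled x : exists i, (z ^+ i * x) ^+ d = 1.
Proof.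
have /cycleP[i xE] := pow_d x; exists (#[z] - i %% #[z])%N.
rewrite expgMn; last exact/commute_sym/commuteX/commute_sym/zC.
rewrite xE -!expgM [(d * _)%N]mulnC !expgM -expgMn; last exact: commuteX2.
rewrite -expgD.
have -> : z ^+ (#[z] - i %% #[z] + i) = 1.
  rewrite expgD -(expg_mod_order z i) -expgD subnK ?expg_order //.
  by rewrite ltnW // ltn_mod order_gt0.
exact: expg1n.
Qed.

Lemma comm_scaled i x u : [~ z ^+ i * x, u] = [~ x, u].
Proof.
rewrite commMgc commXgc (eqP (_ : [~ z, u] == 1)) ?expg1n ?mul1g //.
exact/commgP/zC.
Qed.

Lemma commg_scaled i x u : [~ u, z ^+ i * x] = [~ u, x].
Proof. by rewrite -invg_comm comm_scaled invg_comm. Qed.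

Lemma exists_symplectic_dual k h :
    (forall i j, i < k -> j < k -> commute (h i) (h j)) -> indep k h ->
  exists y : nat -> gT, [/\ dual (fun i : 'I_k => h i) (fun i : 'I_k => y i),
    forall i j, i < k -> j < k -> commute (y i) (y j)
    & forall i, y i ^+ d = 1].
Proof.
move=> hh /(exists_commuting_dual hh)[y hy yy].
have [c yc] := boolp.choice (fun i => exists_scaled (y i)).
exists (fun i => z ^+ c i * y i); split=> // [i j|i j ik jk].
  by rewrite commg_scaled.
by apply/commgP; rewrite comm_scaled commg_scaled; apply/commgP/yy.
Qed.

(** * Extension to a symplectic basis *)

Section Symplectic.

Variables (J : finType) (t t' : J -> gT) (n : nat).
Hypothesis tt' : dual t t'.
Hypothesis t'S : forall x, (forall j, [~ x, t' j] = 1) -> x \in <[z]>.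
Hypothesis tS : forall x, (forall j, [~ x, t j] = 1) -> x \in <[z]>.
Hypothesis cardJ : #|J| = (n + n)%N.

Lemma comm_scalar x u : x \in <[z]> -> [~ x, u] = 1.
Proof.
case/cycleP=> i ->.
exact/eqP/commgP/commute_sym/commuteX/commute_sym/zC.
Qed.

Definition pair_family k (h y : nat -> gT) (i : 'I_k + 'I_k) : gT :=
  match i with inl i => h i | inr i => y i end.
(** The inverse corrects the sign of the alternating form: [y_i, h_j^-1] = [h_j, y_i]. *)
Definition copair_family k (h y : nat -> gT) (i : 'I_k + 'I_k) : gT :=
  match i with inl i => y i | inr i => (h i)^-1 end.

Section Pairs.

Variables (k : nat) (h y : nat -> gT).
Hypothesis hh : forall i j, i < k -> j < k -> commute (h i) (h j).
Hypothesis yy : forall i j, i < k -> j < k -> commute (y i) (y j).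
Hypothesis hy : dual (fun i : 'I_k => h i) (fun i : 'I_k => y i).

Lemma dual_pair_family : dual (@pair_family k h y) (@copair_family k h y).
Proof.
have C1 (x u : gT) : commute x u -> [~ x, u] = 1 by move=> /commgP/eqP.
move=> [] i [] j /=; first exact: hy.
- by rewrite C1 //; apply/commuteV/hh.
- by rewrite C1 //; apply: yy.
by rewrite commgVc -invg_comm invgK hy eq_sym.
Qed.

Lemma dual_copair_family : dual (fun i => (@copair_family k h y i)^-1) (@pair_family k h y).
Proof.
by move=> i j; rewrite commVgc -invg_comm invgK dual_pair_family eq_sym.
Qed.

End Pairs.

Lemma exists_indep_extension k h : k < n ->
    (forall i j, i < k -> j < k -> commute (h i) (h j)) -> indep k h ->
    (forall i, i < k -> h i ^+ d = 1) ->
  exists x, [/\ forall i, i < k -> commute (h i) x, x ^+ d = 1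
    & indep k.+1 (fun i => if i < k then h i else x)].
Proof.
move=> kn hh hi hd; have [y [hy yy _]] := exists_symplectic_dual hh hi.
pose s := @pair_family k h y; pose Q := 'C([set s i | i : 'I_k + 'I_k])%G.
have Qs x i : x \in Q -> [~ x, s i] = 1.
  by move=> /centP xQ; apply/eqP/commgP/xQ/imset_f.
have nS (A : {set gT}) : A \subset 'N(<[z]>).
  apply: cents_norm; apply/subsetP => x _; apply/centP => _ /cycleP[i ->].
  exact/commuteX/commute_sym/zC.
(* Commutativity is what provides an element whose order is the exponent. *)
have abQ : abelian (Q / <[z]>).
  apply: quotient_cents2r; rewrite gen_subG.
  apply/subsetP=> _ /imset2P[u v _ _ ->].
  by rewrite comm_logE -expgM mem_cycle.
(* An element of maximal order modulo scalars in the commutant Q of the pairs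
   (h_i, y_i) does the job; its order e is d by the counting lemma. *)
have [_ /morphimP[x _ xQ ->] xe] := exponent_witness (abelian_nil abQ).
set e := exponent _ in xe.
have cosetX u b : (coset <[z]> u ^+ b == 1) = (u ^+ b \in <[z]>).
  have uN v : v \in 'N(<[z]>) by rewrite (subsetP (nS setT)) ?inE.
  rewrite -morphX //; apply/eqP/idP => [|uz]; first exact: coset_idr.
  exact: coset_id.
have e_pow u : u \in Q -> u ^+ e \in <[z]>.
  move=> uQ; rewrite -cosetX; apply/eqP/expg_exponent/mem_quotient.
  exact: uQ.
have ed : e %| d.
  apply/exponentP => _ /morphimP[u _ uQ ->]; apply/eqP; rewrite cosetX.
  have /cycleP[i ->] := pow_d u; rewrite -expgM; exact: mem_cycle.
have e_eq : e = d.
  have ef : (e * (d %/ e))%N = d by rewrite mulnC divnK.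
  have sQ : nondeg s e.
    move=> u us v; rewrite -commXgc comm_scalar // e_pow //.
    apply/centP => _ /imsetP[i _ ->]; exact/commgP/eqP.
  have := dual_card_le ef tt' (dual_copair_family hh yy hy) sQ.
  rewrite cardJ card_sum !card_ord; case: (ltngtP (d %/ e) 1) => [f0|f1|f1].
  - move: (d_gt0); rewrite -[in X in 0 < X -> _]ef.
    by case: (d %/ e) f0; rewrite // muln0.
  - by rewrite leq_exp2l // !addnn leq_double leqNgt kn.
  - by move: ef; rewrite f1 muln1.
(* If [b] kills all commutators of [x], then x^b commutes with all [t j], hence is a scalar, and the
   order [e = d] of [x] modulo scalars divides [b]. *)
have xind b : (forall u, [~ x, u] ^+ b = 1) -> d %| b.
  move=> xb; rewrite -e_eq xe order_dvdn cosetX; apply: tS => j.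
  by rewrite commXgc.
have [c xd] := exists_scaled x.
pose h1 i := if i < k then h i else z ^+ c * x.
exists (z ^+ c * x); rewrite -/h1; split=> //.
  move=> i ik; apply/commgP; rewrite commg_scaled -invg_comm invg_eq1.
  by apply/eqP; apply: (Qs _ (inl (Ordinal ik))).
(* Pairing the relation with [y i], which commutes with [x], isolates [a i]. The part in the [h i]
   is then trivial by [hd], and only a power of [x] remains. *)
move=> a ha; have ai i : i < k -> d %| a i.
  move=> ik; have xy : [~ x, y i] = 1 := Qs _ (inr (Ordinal ik)) xQ.
  have := ha (y i); rewrite (prod_powS k h1 a) commMgc {2}/h1 ltnn.
  rewrite commXgc comm_scaled xy expg1n mulg1 /prod_pow.
  under eq_bigr do rewrite /h1 ltn_ord.
  rewrite -/(prod_pow _ _) (@comm_prod_pow_dual _ _ _ _ (Ordinal ik) hy) => /eqP.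
  by rewrite q_eq1.
move=> i; rewrite ltnS leq_eqVlt => /orP[/eqP->|]; last exact: ai.
apply: xind => u; have := ha u; rewrite (prod_powS k h1 a) commMgc {2}/h1 ltnn.
rewrite commXgc comm_scaled.
rewrite (_ : prod_pow _ _ = 1) ?comm1g ?mul1g //.
apply: big1 => j _; rewrite /h1 ltn_ord.
have /dvdnP[m ->] := ai j (ltn_ord j).
by rewrite mulnC expgM hd // expg1n.
Qed.

Lemma nondeg_t' : nondeg t' 1.
Proof. by move=> x xt u; rewrite expg1 comm_scalar ?t'S. Qed.

(** The 2k members of the pairs are measured against the 2n members of [t'], with [e = 1] and
    [f = d > 1]. *)
Lemma indep_card_le k h : 1 < d ->
    (forall i j, i < k -> j < k -> commute (h i) (h j)) -> indep k h ->
  k <= n.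
Proof.
move=> d1 hh hi; have [y hy yy] := exists_commuting_dual hh hi.
have := dual_card_le (mul1n d) (dual_pair_family hh yy hy) tt' nondeg_t'.
by rewrite cardJ card_sum !card_ord leq_exp2l // !addnn leq_double.
Qed.

Lemma exists_indep_basis k m h : m + k <= n ->
    (forall i j, i < k -> j < k -> commute (h i) (h j)) -> indep k h ->
    (forall i, i < k -> h i ^+ d = 1) ->
  exists h', [/\ forall i, i < k -> h' i = h i,
    forall i j, i < m + k -> j < m + k -> commute (h' i) (h' j),
    indep (m + k) h' & forall i, i < m + k -> h' i ^+ d = 1].
Proof.
elim: m => [|m IH] mkn hh hi hd; first by exists h.
have [h' [h'h h'h' h'i h'd]] := IH (ltnW mkn) hh hi hd.
have [x [xh xd xi]] := exists_indep_extension mkn h'h' h'i h'd.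
exists (fun i => if i < m + k then h' i else x); split=> // [i ik|i j|i _].
- by rewrite (leq_trans ik) ?leq_addl // h'h.
- case: ifP => im; case: ifP => jm _ _ //.
  + exact: h'h'.
  + exact: xh.
  + exact/commute_sym/xh.
by case: ifP => // im; apply: h'd.
Qed.

(** For the last clause, the n pairs have as many members as [t], so [dual_generate] matches the
    commutators of [x]; what is left over commutes with everything, hence is a scalar. *)
Lemma symplectic_basis k h : k <= n ->
    (forall i j, i < k -> j < k -> commute (h i) (h j)) -> indep k h ->
    (forall i, i < k -> h i ^+ d = 1) ->
  exists h' y, [/\ forall i, i < k -> h' i = h i,
    [/\ forall i j, i < n -> j < n -> commute (h' i) (h' j),
        forall i j, i < n -> j < n -> commute (y i) (y j)
      & dual (fun i : 'I_n => h' i) (fun i : 'I_n => y i)],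
    (forall i, i < n -> h' i ^+ d = 1) /\ (forall i, y i ^+ d = 1)
    & forall x, exists s a b, s \in <[z]> /\
        x = s * (prod_pow (fun i : 'I_n => h' i) a * prod_pow (fun i : 'I_n => y i) b)].
Proof.
move=> kn hh hi hd.
have mkn : n - k + k <= n by rewrite subnK.
have [h' [h'h hh' hi' hd']] := exists_indep_basis mkn hh hi hd.
rewrite subnK // in hh' hi' hd' *.
have [y [hy yy yd]] := exists_symplectic_dual hh' hi'.
exists h', y; split=> // x.
have [|a xa] := dual_generate x _ (dual_pair_family hh' yy hy) tt' nondeg_t'.
  by rewrite cardJ card_sum !card_ord.
exists (x * (prod_pow (@pair_family n h' y) a)^-1).
exists (fun i => a (inl i)), (fun i => a (inr i)).
split; last first.
  have <- : prod_pow (@pair_family n h' y) a =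
      prod_pow (fun i : 'I_n => h' i) (fun i => a (inl i)) *
      prod_pow (fun i : 'I_n => y i) (fun i => a (inr i)) by exact: big_sumType.
  by rewrite mulgKV.
by apply: tS => j; rewrite commMgc commVgc xa mulgV.
Qed.

End Symplectic.
End CommutatorForm.

(** * Bases of groups isomorphic to (Z/d)^k *)

Section FreeBasis.

Local Open Scope group_scope.

Lemma isog_setXn_Zp_basis (gT : finGroupType) (H : {group gT}) k d :
    0 < d -> H \isog setXn (fun _ : 'I_k => Zp d) ->
  exists h : 'I_k -> gT, [/\ forall i, h i \in H, forall i, h i ^+ d = 1,
    forall x, x \in H -> exists a, x = prod_pow h a
    & forall a, prod_pow h a = 1 -> forall i, d %| a i].
Proof.
move=> d_gt0; rewrite isog_sym => /isogP[f /injmP injf fH].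
(* For [d = 1] the type 'Z_d has two elements and [Zp d] is its trivial subgroup, generated by 1. *)
have [g Zg] : exists g, Zp d = <[g]>.
  rewrite /Zp; case: ifP => _; last by exists 1; rewrite cycle1.
  by exists Zp1; rewrite Zp_cycle.
have og : #[g] = d by rewrite orderE -Zg card_Zp.
have gd : g ^+ d = 1 by apply/eqP; rewrite -order_dvdn og.
pose XZ := setXn (fun _ : 'I_k => Zp d).
pose e (i : 'I_k) : {dffun forall _ : 'I_k, 'Z_d} := [ffun j => g ^+ (i == j)].
have eX i : e i \in XZ.
  by apply/setXnP => j; rewrite ffunE Zg mem_cycle.
have expE (x : {dffun forall _ : 'I_k, 'Z_d}) m j : (x ^+ m) j = x j ^+ m.
  elim: m => [|m IH]; first by rewrite !expg0 ffunE.
  by rewrite !expgS -IH ffunE.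
have prodE a j : prod_pow e a j = g ^+ a j.
  rewrite -(sum_delta a j) /prod_pow; elim/big_rec2: _ => [|i m x _ IH].
    by rewrite ffunE.
  by rewrite ffunE IH expE ffunE -expgM mulnC expgD.
have fpe a : f (prod_pow e a) = prod_pow (f \o e) a.
  rewrite /prod_pow morph_prod; last by move=> i _; apply: groupX; apply: eX.
  by apply: eq_bigr => i _; rewrite morphX //; apply: eX.
have peX a : prod_pow e a \in XZ.
  by apply: group_prod => i _; apply: groupX; apply: eX.
exists (f \o e); split.
- by move=> i; rewrite -fH mem_morphim //; apply: eX.
- move=> i; rewrite /= -morphX; last exact: eX.
  rewrite (_ : e i ^+ d = 1) ?morph1 //; apply/ffunP=> j.
  by rewrite expE !ffunE -expgM mulnC expgM gd expg1n.
- move=> x; rewrite -fH => /morphimP[u uX _ ->].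
  have /fin_all_exists[a ua] i : exists a, u i = g ^+ a.
    by apply/cycleP; rewrite -Zg; move/setXnP: uX => /(_ i).
  exists a; rewrite -fpe; congr (f _); apply/ffunP=> i.
  by rewrite prodE.
move=> a; rewrite -fpe -(morph1 f) => /injf pe1 i.
have := prodE a i; rewrite pe1 ?group1 ?peX // ffunE => /esym/eqP.
by rewrite -order_dvdn og.
Qed.

End FreeBasis.

Local Open Scope ring_scope.

(** * The Pauli group *)

Section PauliFacts.

Variables (C : numClosedFieldType) (d : nat) (zeta : C).
Hypothesis zetaP : (dbar d).-primitive_root zeta.
Variable n : nat.

Local Notation P := (pauli zetaP n).
Local Notation V := (qudits C d n).
Local Notation I := {ffun 'I_n -> 'I_d}.
Local Notation z := (pauli_zeta zetaP n).
Local Notation xi := (zeta ^+ 2).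

Lemma dim_gt0 : (0 < d)%N.
Proof. by have := prim_order_gt0 zetaP; rewrite /dbar; case: d. Qed.

Lemma xi_d : xi ^+ d = 1.
Proof.
rewrite -exprM; apply/eqP; rewrite -(prim_order_dvd zetaP) /dbar.
by case: odd; [apply: dvdn_mull | rewrite mul2n].
Qed.

Lemma xi_eq1 i : (xi ^+ i == 1) = (d %| i)%N.
Proof.
rewrite -exprM -(prim_order_dvd zetaP) /dbar; case: ifP => od.
  by rewrite Gauss_dvdr // coprimen2.
by rewrite -muln2 mulnC dvdn_pmul2l.
Qed.

Lemma xi_prim : d.-primitive_root xi.
Proof.
have [m xm md] := prim_order_exists dim_gt0 xi_d.
suff <- : m = d by [].
by apply/eqP; rewrite eqn_dvd md -xi_eq1 (prim_expr_order xm) eqxx.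
Qed.

Lemma xi_ordS (i : 'I_d) : xi ^+ ordS i = xi ^+ i.+1.
Proof. by rewrite /= -[in RHS](expr_mod i.+1 xi_d). Qed.

Lemma xi_ord_pred (i : 'I_d) : xi ^+ (ord_pred i).+1 = xi ^+ i.
Proof. by rewrite -xi_ordS ord_predK. Qed.

Lemma pauliM (x y : P) v : pauli_op (x * y)%g v = pauli_op x (pauli_op y v).
Proof. exact: comp_lfunE. Qed.

Lemma pauli1 v : pauli_op (1%g : P) v = v.
Proof. exact: id_lfunE. Qed.

Lemma pauli_eq (x y : P) : (forall v, pauli_op x v = pauli_op y v) -> x = y.
Proof. by move=> xy; apply/val_inj/lfunP. Qed.

Lemma qscaleE a (v : V) j : (a *: v) j = a * v j.
Proof. by rewrite ffunE. Qed.

Definition pX (r : 'I_n) : P :=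
  Pauli zetaP (boolp.asboolT (pauli_genX d zeta r)).
Definition pZ (r : 'I_n) : P :=
  Pauli zetaP (boolp.asboolT (pauli_genZ d zeta r)).

Lemma pauli_zetaE v : pauli_op z v = zeta *: v.
Proof. by rewrite /= scale_lfunE id_lfunE. Qed.

Lemma pauli_zetaX i v : pauli_op (z ^+ i)%g v = zeta ^+ i *: v.
Proof.
elim: i => [|i IH]; first by rewrite expg0 pauli1 scale1r.
by rewrite expgS pauliM IH pauli_zetaE scalerA exprS.
Qed.

Lemma pX_E r v j : pauli_op (pX r) v j = v (upd j r (ord_pred (j r))).
Proof.
rewrite onfactorE ffunE (bigD1 (ord_pred (j r))) //= !mxE ord_predK eqxx mul1r.
rewrite big1 ?addr0 // => i /negPf ij; rewrite mxE; case: eqP => [jE|_].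
  by move: ij; rewrite jE ordSK eqxx.
by rewrite mul0r.
Qed.

Lemma upd_id (j : I) r : upd j r (j r) = j.
Proof. by apply/ffunP=> i; rewrite ffunE; case: eqP => // ->. Qed.

Lemma pZ_E r v j : pauli_op (pZ r) v j = xi ^+ j r * v j.
Proof.
rewrite onfactorE ffunE (bigD1 (j r)) //= !mxE eqxx mulr1n upd_id.
rewrite big1 ?addr0 // => i /negPf ij.
by rewrite !mxE eq_sym ij mulr0n mul0r.
Qed.

(** Inverses need no case of their own: the group is finite, so they are non-negative powers. *)
Lemma pauli_ind (Q : P -> Prop) : Q 1%g -> Q z -> (forall r, Q (pX r)) ->
    (forall r, Q (pZ r)) -> (forall x y, Q x -> Q y -> Q (x * y)%g) ->
  forall x, Q x.
Proof.
move=> Q1 Qz QX QZ QM.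
have QV x : Q x -> Q (x^-1)%g.
  move=> Qx; rewrite -[(x^-1)%g]mul1g -(expg_order x) -(prednK (order_gt0 x)).
  rewrite expgSr mulgK; elim: (_.-1)%N => [|i IH]; first exact: Q1.
  by rewrite expgS; apply: QM.
suff QP f : pauli_gen zeta f -> forall x : P, pauli_op x = f -> Q x.
  by move=> x; apply: (QP _ (boolp.asboolW (pauli_opP x))).
elim=> {f}.
- by move=> x xE; rewrite (_ : x = 1%g) //; apply: val_inj.
- by move=> x xE; rewrite (_ : x = z) //; apply: val_inj.
- by move=> r x xE; rewrite (_ : x = pX r) //; apply: val_inj.
- by move=> r x xE; rewrite (_ : x = pZ r) //; apply: val_inj.
- move=> f g pf Qf pg Qg x xE.
  pose x1 : P := Pauli zetaP (boolp.asboolT pf).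
  pose x2 : P := Pauli zetaP (boolp.asboolT pg).
  rewrite (_ : x = (x1 * x2)%g); last exact: val_inj.
  by apply: QM; [apply: Qf|apply: Qg].
move=> f pf Qf x xE; pose x1 : P := Pauli zetaP (boolp.asboolT pf).
rewrite (_ : x = (x1^-1)%g); last exact: val_inj.
by apply/QV/Qf.
Qed.

Lemma pauli_zetaC (x : P) : commute z x.
Proof. by apply: pauli_eq => v; rewrite !pauliM !pauli_zetaE linearZ. Qed.

Lemma pauli_zetaXC i (x : P) : commute (z ^+ i)%g x.
Proof. exact/commute_sym/commuteX/commute_sym/pauli_zetaC. Qed.

Lemma upd_updC (j : I) r s a b :
  r != s -> upd (upd j r a) s b = upd (upd j s b) r a.
Proof.
move=> rs; apply/ffunP=> i; rewrite !ffunE; case: eqP => // -> .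
by rewrite eq_sym (negPf rs).
Qed.

Lemma upd_upd (j : I) r a b : upd (upd j r a) r b = upd j r b.
Proof. by apply/ffunP=> i; rewrite !ffunE; case: eqP. Qed.

Lemma updE (j : I) r a : upd j r a r = a.
Proof. by rewrite ffunE eqxx. Qed.

Lemma updN (j : I) r s a : s != r -> upd j r a s = j s.
Proof. by move=> /negPf sr; rewrite ffunE sr. Qed.

Lemma pX_C r s : commute (pX r) (pX s).
Proof.
apply: pauli_eq => v; apply/ffunP => j; rewrite !pauliM !pX_E.
by have [->//|rs] := eqVneq r s; rewrite !updN // 1?eq_sym // upd_updC.
Qed.

Lemma pZ_C r s : commute (pZ r) (pZ s).
Proof.
by apply: pauli_eq => v; apply/ffunP => j; rewrite !pauliM !pZ_E mulrCA.
Qed.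

Lemma comm_pZ_pX r s : [~ pZ r, pX s]%g = ((z ^+ 2) ^+ (r == s))%g.
Proof.
apply: (mulgI (pX s * pZ r)%g); rewrite -commgC.
apply: pauli_eq => v; apply/ffunP => j; rewrite -expgM !pauliM pauli_zetaX.
rewrite pZ_E !pX_E pZ_E qscaleE.
have [->|rs] := eqVneq r s; last by rewrite updN // mul1r.
by rewrite updE muln1 -xi_ord_pred exprSr -mulrA.
Qed.

(** The bilinearity lemmas for commutators presuppose this membership, so closure under products is
    redone locally in [comM] and the generators are checked in each argument. *)
Lemma comm_pauli (x y : P) : [~ x, y]%g \in <[z ^+ 2]>%g.
Proof.
have qC g u : g \in <[z ^+ 2]>%g -> commute (u : P) g.
  by case/cycleP=> i ->; rewrite -expgM; apply/commute_sym/pauli_zetaXC.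
have comM u v w : [~ u, w]%g \in <[z ^+ 2]>%g -> [~ v, w]%g \in <[z ^+ 2]>%g ->
    [~ u * v, w]%g \in <[z ^+ 2]>%g.
  move=> uw vw; rewrite commMgJ groupM //.
  by rewrite conjgE -(qC _ _ uw) mulKg.
have comS u v : [~ u, v]%g \in <[z ^+ 2]>%g -> [~ v, u]%g \in <[z ^+ 2]>%g.
  by rewrite -invg_comm groupV.
have c1 u v : commute u v -> [~ u, v]%g \in <[z ^+ 2]>%g.
  by move=> /commgP/eqP->; apply: group1.
have XZ r s : [~ pX r, pZ s]%g \in <[z ^+ 2]>%g.
  by apply: comS; rewrite comm_pZ_pX mem_cycle.
elim/pauli_ind: x => [||r|r|x1 x2]; last exact: comM.
- exact/c1/commute_sym/commute1.
- exact/c1/pauli_zetaC.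
- apply/comS; elim/pauli_ind: y => [||s|s|y1 y2]; last exact: comM.
  + exact/c1/commute_sym/commute1.
  + exact/c1/pauli_zetaC.
  + exact/c1/pX_C.
  + exact/comS/XZ.
- apply/comS; elim/pauli_ind: y => [||s|s|y1 y2]; last exact: comM.
  + exact/c1/commute_sym/commute1.
  + exact/c1/pauli_zetaC.
  + exact: XZ.
  + exact/c1/pZ_C.
Qed.

Definition index0 : I := [ffun => Ordinal dim_gt0].

Lemma pauli_zetaX_eq1 i : ((z ^+ i)%g == 1%g) = (dbar d %| i)%N.
Proof.
rewrite (prim_order_dvd zetaP); apply/eqP/eqP => zi; last first.
  by apply: pauli_eq => v; rewrite pauli_zetaX zi scale1r pauli1.
have := pauli_zetaX i [ffun=> 1]; rewrite zi pauli1 => /ffunP/(_ index0).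
by rewrite !ffunE => ->; rewrite /GRing.scale /= mulr1.
Qed.

Lemma order_zeta2 : #[(z ^+ 2)%g]%g = d.
Proof.
have E i : (#[(z ^+ 2)%g]%g %| i)%N = (d %| i)%N.
  rewrite order_dvdn -expgM pauli_zetaX_eq1 (prim_order_dvd zetaP) exprM.
  exact: xi_eq1.
by apply/eqP; rewrite eqn_dvd E dvdnn -E dvdnn.
Qed.

Lemma pX_d r : (pX r ^+ d = 1)%g.
Proof.
have XiE i v j : pauli_op (pX r ^+ i)%g v j =
    v (upd j r (iter i (@ord_pred d) (j r))).
  elim: i v j => [|i IH] v j; first by rewrite expg0 pauli1 upd_id.
  by rewrite expgSr pauliM IH pX_E upd_upd updE -iterS.
apply: pauli_eq => v; apply/ffunP=> j; rewrite XiE pauli1.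
rewrite (_ : iter _ _ _ = j r) ?upd_id //; apply: val_inj.
have iterE i : val (iter i (@ord_pred d) (j r)) = ((j r + i * d.-1) %% d)%N.
  elim: i => [|i IH]; first by rewrite addn0 modn_small.
  rewrite iterS /= IH -subn1 -addnBA ?dim_gt0 // subn1 modnDml -addnA.
  by rewrite mulSn [(d.-1 + _)%N]addnC.
by rewrite iterE mulnC addnC modnMDl modn_small.
Qed.

Lemma pZ_d r : (pZ r ^+ d = 1)%g.
Proof.
have ZiE i v j : pauli_op (pZ r ^+ i)%g v j = xi ^+ (j r * i) * v j.
  elim: i v j => [|i IH] v j; first by rewrite expg0 pauli1 muln0 mul1r.
  by rewrite expgSr pauliM IH pZ_E mulrA -exprD mulnS addnC.
apply: pauli_eq => v; apply/ffunP=> j.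
by rewrite ZiE mulnC exprM xi_d expr1n mul1r pauli1.
Qed.

(** In the product case (xy)^d differs from x^d y^d by [y, x]^(d(d-1)/2). As [y, x] is a power of
    z^2, the factor 2 cancels the denominator and leaves a power of z^d. *)
Lemma pauli_pow_d (x : P) : (x ^+ d)%g \in <[(z ^+ d)%g]>%g.
Proof.
elim/pauli_ind: x => [||r|r|x y xd yd].
- by rewrite expg1n group1.
- exact: cycle_id.
- by rewrite pX_d group1.
- by rewrite pZ_d group1.
have /cycleP[i yx] := comm_pauli y x.
have cq u : commute u [~ y, x]%g by rewrite yx -expgM; apply/commute_sym/pauli_zetaXC.
rewrite expMg_Rmul // !groupM // yx -!expgM mulnCA -mul_bin_diag.
by rewrite mulnCA expgM mem_cycle.
Qed.

(** Take [x] in monomial form. Commuting with all Z_r makes the permutation trivial, because the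
    eigenvalues of the Z_r separate basis vectors; commuting with all X_r makes the phase invariant
    under shifts of each coordinate, hence constant. *)
Lemma pauli_scalar (x : P) : (forall r, commute x (pZ r)) ->
  (forall r, commute x (pX r)) -> x \in <[z]>%g.
Proof.
have [[e s] xE] := pauli_monomial zetaP (boolp.asboolW (pauli_opP x)).
have xv v j : pauli_op x v j = zeta ^+ e j * v (s j).
  by rewrite xE monomialE ffunE.
have zeta_neq0 i : zeta ^+ i != 0.
  apply: expf_neq0; apply: contra_neq (oner_neq0 C) => z0.
  by rewrite -(prim_expr_order zetaP) z0 expr0n gtn_eqF ?(prim_order_gt0 zetaP).
move=> xZ xX; have s1 j : s j = j.
  apply/ffunP => r; pose v : V := [ffun i => (i == s j)%:R].
  have : pauli_op (x * pZ r)%g v j = pauli_op (pZ r * x)%g v j by rewrite xZ.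
  rewrite !pauliM xv !pZ_E xv /v !ffunE eqxx !mulr1 mulrC.
  move/(mulIf (zeta_neq0 _)) => xijs; apply/val_inj/eqP.
  rewrite -[val (s j r)](modn_small (ltn_ord _)).
  rewrite -[val (j r)](modn_small (ltn_ord _)).
  by rewrite -(eq_prim_root_expr xi_prim) xijs eqxx.
have eX j r : zeta ^+ e j = zeta ^+ e (upd j r (ord_pred (j r))).
  pose v : V := [ffun=> 1].
  have : pauli_op (x * pX r)%g v j = pauli_op (pX r * x)%g v j by rewrite xX.
  by rewrite !pauliM xv !pX_E xv /v !ffunE !mulr1.
have e_upd j r i : zeta ^+ e (upd j r i) = zeta ^+ e j.
  have e_upd0 a :
   forall ad : (a < d)%N,
      zeta ^+ e (upd j r (Ordinal ad)) = zeta ^+ e (upd j r (Ordinal dim_gt0)).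
    elim: a => [|a IH] ad; first by congr (_ ^+ e (upd _ _ _)); apply: val_inj.
    rewrite (eX _ r) upd_upd updE (_ : ord_pred _ = Ordinal (ltnW ad)) ?IH ?ltnW //.
    by apply: val_inj; rewrite /= modnDr modn_small // ltnW.
  rewrite -[in RHS](upd_id j r); case: i (j r) => [i lid] [i' lid'].
  by rewrite !e_upd0.
have ee j : zeta ^+ e j = zeta ^+ e index0.
  pose f (l : seq 'I_n) : I := [ffun i => if i \in l then Ordinal dim_gt0 else j i].
  have fl l : zeta ^+ e (f l) = zeta ^+ e j.
    elim: l => [|r l IH]; first by congr (_ ^+ e _); apply/ffunP=> i; rewrite ffunE.
    rewrite -IH -(e_upd (f l) r (Ordinal dim_gt0)); congr (_ ^+ e _).
    by apply/ffunP=> i; rewrite !ffunE inE; case: eqP.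
  rewrite -(fl (enum 'I_n)); congr (_ ^+ e _).
  by apply/ffunP=> i; rewrite !ffunE mem_enum.
apply/cycleP; exists (e index0); apply: pauli_eq => v; apply/ffunP => j.
by rewrite xv pauli_zetaX s1 qscaleE ee.
Qed.

End PauliFacts.

(** * A symplectic basis of the Pauli group adapted to H *)

Section PauliBasis.

Variables (C : numClosedFieldType) (d : nat) (zeta : C).
Hypothesis zetaP : (dbar d).-primitive_root zeta.
Variable n : nat.

Local Open Scope group_scope.
Local Notation P := (pauli zetaP n).
Local Notation z := (pauli_zeta zetaP n).

Definition pZX (i : 'I_n + 'I_n) : P :=
  match i with inl r => pZ zetaP r | inr r => pX zetaP r end.
Definition pXZ (i : 'I_n + 'I_n) : P :=
  match i with inl r => pX zetaP r | inr r => (pZ zetaP r)^-1 end.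

Lemma dual_pZX : dual z pZX pXZ.
Proof.
have C1 (x u : P) : commute x u -> [~ x, u] = 1 by move=> /commgP/eqP.
move=> [] r [] s /=; first exact: comm_pZ_pX.
- by rewrite C1 //; apply/commuteV/pZ_C.
- by rewrite C1 //; apply: pX_C.
rewrite (commgVc (@pauli_zetaC _ _ _ zetaP n) (@comm_pauli _ _ _ zetaP n)).
by rewrite -invg_comm invgK comm_pZ_pX eq_sym.
Qed.

Lemma pZX_scalar x : (forall i, [~ x, pZX i] = 1) -> x \in <[z]>.
Proof.
move=> xC; apply: pauli_scalar => r; apply/commgP/eqP.
- exact: (xC (inl r)).
- exact: (xC (inr r)).
Qed.

Lemma pXZ_scalar x : (forall i, [~ x, pXZ i] = 1) -> x \in <[z]>.
Proof.
move=> xC; apply: pauli_scalar => r.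
- by rewrite -[pZ _ _]invgK; apply/commuteV/commgP/eqP/(xC (inr r)).
- exact/commgP/eqP/(xC (inl r)).
Qed.

Lemma pauli_symplectic_basis k (H : {group P}) :
    (d = 1%N -> k <= n)%N -> abelian H -> H :&: <[z]> = 1 ->
    H \isog setXn (fun _ : 'I_k => Zp d) ->
  (k <= n)%N /\ exists h y : nat -> P,
    [/\ forall i, (i < k)%N -> h i \in H,
        forall x, x \in H -> exists a, x = prod_pow (fun i : 'I_k => h i) a,
    [/\ forall i j, (i < n)%N -> (j < n)%N -> commute (h i) (h j),
        forall i j, (i < n)%N -> (j < n)%N -> commute (y i) (y j)
      & dual z (fun i : 'I_n => h i) (fun i : 'I_n => y i)],
    (forall i, (i < n)%N -> h i ^+ d = 1) /\ (forall i, y i ^+ d = 1)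
    & forall x, exists s a b, s \in <[z]> /\
        x = s * (prod_pow (fun i : 'I_n => h i) a * prod_pow (fun i : 'I_n => y i) b)].
Proof.
move=> kn1 abH Hz /(isog_setXn_Zp_basis (dim_gt0 zetaP))[g [gH gd Hg g1]].
pose h i : P := if insub i is Some i' then g i' else 1.
have hg (i : 'I_k) : h i = g i by rewrite /h valK.
have hgk i (ik : (i < k)%N) : h i = g (Ordinal ik) by rewrite -hg.
have hH i : (i < k)%N -> h i \in H by move=> ik; rewrite hgk.
have hh i j : (i < k)%N -> (j < k)%N -> commute (h i) (h j).
  by move=> ik jk; apply: (centsP abH); apply: hH.
(* A product of the [h i] commuting with everything is a scalar in [H], hence 1, and freeness of the
   basis applies. *)
have hi : indep d k h.
  move=> a ha i ik; apply: (g1 (fun i => a i) _ (Ordinal ik)).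
  rewrite (_ : prod_pow _ _ = prod_pow (fun i : 'I_k => h i) (fun i => a i)).
    apply/set1gP; rewrite -Hz inE; apply/andP; split.
      by apply: group_prod => j _; apply/groupX/hH.
    by apply: pZX_scalar => j; apply: ha.
  by apply: eq_bigr => j _; rewrite hg.
have hd i : (i < k)%N -> h i ^+ d = 1 by move=> ik; rewrite hgk.
(* The count compares powers of [d], so it says nothing for [d = 1]; there the bound is [kn1]. *)
have kn : (k <= n)%N.
  have [d1|d1|d1] := ltngtP 1%N d; last exact/kn1/esym.
    apply: (indep_card_le (@pauli_zetaC _ _ _ zetaP n) (@comm_pauli _ _ _ zetaP n)
      (@order_zeta2 _ _ _ zetaP n) dual_pZX pXZ_scalar) hh hi => //.
    by rewrite card_sum card_ord.
  by have := dim_gt0 zetaP; case: d d1 => // [[]].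
split=> //.
have [|h' [y [h'h rel ords gen]]] := symplectic_basis (@pauli_zetaC _ _ _ zetaP n)
  (@comm_pauli _ _ _ zetaP n) (@order_zeta2 _ _ _ zetaP n)
  (@pauli_pow_d _ _ _ zetaP n) dual_pZX pXZ_scalar pZX_scalar _ kn hh hi hd.
  by rewrite card_sum card_ord.
exists h', y; split=> // [i ik|x /Hg[a ->]].
  by rewrite h'h // hH.
by exists a; apply: eq_bigr => i _; rewrite h'h ?hg.
Qed.

End PauliBasis.

(** * Encoding isometries *)

Lemma prod_pow_incr (gT : finGroupType) (I : finType) (s : I -> gT) a r :
    (forall i, commute (s r) (s i)) ->
  (s r * prod_pow s a = prod_pow s (fun i => (i == r) + a i)%N)%g.
Proof.
move=> sC; rewrite /prod_pow.
(* Generalised to an arbitrary list, where one factor [s r] comes from each occurrence of [r]. *)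
have -> : (\prod_i s i ^+ ((i == r) + a i) =
    s r ^+ count_mem r (index_enum I) * \prod_i s i ^+ a i)%g.
  elim: (index_enum I) => [|i l IH]; first by rewrite !big_nil mulg1.
  rewrite !big_cons IH expgD !mulgA /= eq_sym; congr (_ * _)%g.
  rewrite expgD; case: eqP => [<-|_]; last first.
    by rewrite !expg0 !mul1g; apply: commuteX2; apply/commute_sym/sC.
  rewrite !expg1 -!mulgA; congr (_ * _)%g.
  by apply: commuteX2; apply/commute_sym/sC.
by rewrite count_uniq_mem ?index_enum_uniq // mem_index_enum expg1.
Qed.

Section Hdot.

Variables (C : numClosedFieldType) (d n : nat).
Local Notation V := (qudits C d n).

Lemma hdot_suml (I : finType) (a : I -> C) (u : I -> V) v :
  hdot (\sum_i a i *: u i) v = \sum_i a i * hdot (u i) v.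
Proof.
rewrite /hdot; under [RHS]eq_bigr do rewrite mulr_sumr.
rewrite exchange_big /=; apply: eq_bigr => j _.
rewrite sum_ffunE mulr_suml; apply: eq_bigr => i _.
by rewrite qscaleE mulrA.
Qed.

Lemma hdot_sumr (I : finType) (a : I -> C) (u : I -> V) v :
  hdot v (\sum_i a i *: u i) = \sum_i (a i)^* * hdot v (u i).
Proof.
rewrite /hdot; under [RHS]eq_bigr do rewrite mulr_sumr.
rewrite exchange_big /=; apply: eq_bigr => j _.
rewrite sum_ffunE rmorph_sum mulr_sumr; apply: eq_bigr => i _.
by rewrite qscaleE rmorphM mulrCA.
Qed.

Lemma hdotZ a b (u v : V) : hdot (a *: u) (b *: v) = a * b^* * hdot u v.
Proof.
rewrite /hdot mulr_sumr; apply: eq_bigr => j _.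
by rewrite !qscaleE rmorphM mulrACA.
Qed.

Lemma hdot_ge0 (v : V) : 0 <= hdot v v.
Proof. by apply: sumr_ge0 => j _; apply: mul_conjC_ge0. Qed.

Lemma hdot_eq0 (v : V) : (hdot v v == 0) = (v == 0).
Proof.
apply/eqP/eqP => [v0|->]; last by apply: big1 => j _; rewrite ffunE mul0r.
apply/ffunP=> j; rewrite ffunE; apply/eqP; rewrite -mul_conjC_eq0.
by rewrite (psumr_eq0P (fun i _ => mul_conjC_ge0 (v i)) v0).
Qed.

End Hdot.

(** * Unitarity and joint fixed vectors *)

Section PauliUnitary.

Variables (C : numClosedFieldType) (d : nat) (zeta : C).
Hypothesis zetaP : (dbar d).-primitive_root zeta.
Variable n : nat.
Local Notation P := (pauli zetaP n).
Local Notation V := (qudits C d n).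
Local Notation z := (pauli_zeta zetaP n).

Lemma norm_zeta : `|zeta| = 1.
Proof.
apply/eqP; rewrite -(@pexpr_eq1 _ _ (dbar d)) ?normr_ge0 //.
  by rewrite -normrX prim_expr_order // normr1.
exact: prim_order_gt0 zetaP.
Qed.

Lemma pauli_unitary (x : P) (u v : V) :
  hdot (pauli_op x u) (pauli_op x v) = hdot u v.
Proof.
have [[e s] ->] := pauli_monomial zetaP (boolp.asboolW (pauli_opP x)).
rewrite /hdot [RHS](reindex_inj (@perm_inj _ s)); apply: eq_bigr => j _.
rewrite !monomialE !ffunE /= rmorphM mulrACA -normCK normrX.
by rewrite norm_zeta !expr1n mul1r.
Qed.

Lemma pauli_sum (x : P) (I : finType) (F : I -> V) :
  pauli_op x (\sum_i F i) = \sum_i pauli_op x (F i).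
Proof. exact: linear_sum. Qed.

Lemma pauliZ (x : P) a v : pauli_op x (a *: v) = a *: pauli_op x v.
Proof. exact: linearZ. Qed.

Lemma pauli_fixedM (x y : P) v :
  pauli_op x v = v -> pauli_op y v = v -> pauli_op (x * y)%g v = v.
Proof. by rewrite pauliM => xv ->. Qed.

Lemma pauli_fixedX (x : P) i v : pauli_op x v = v -> pauli_op (x ^+ i)%g v = v.
Proof.
move=> xv; elim: i => [|i IH]; first by rewrite expg0 pauli1.
by rewrite expgS pauli_fixedM.
Qed.

Lemma pauli_sum_pow (x : P) v : (x ^+ d = 1)%g ->
  pauli_op x (\sum_(a < d) pauli_op (x ^+ a)%g v) =
  \sum_(a < d) pauli_op (x ^+ a)%g v.
Proof.
(* After adding [v], both sides are the sum over the exponents 0 to d, with the first or the last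
   term split off. *)
move=> xd; rewrite pauli_sum; apply: (@addrI _ v).
transitivity (\sum_(a < d.+1) pauli_op (x ^+ a)%g v).
  rewrite big_ord_recl expg0 pauli1; congr (_ + _).
  by apply: eq_bigr => a _; rewrite -pauliM -expgS.
by rewrite big_ord_recr /= xd pauli1 addrC.
Qed.

(** The plain sum over powers of [x] vanishes when [v] has no component fixed by [x]. Powers of [y]
    shift the eigenvalues of [x] by powers of xi, so one of them brings some component of [v] to
    eigenvalue 1. *)
Lemma pauli_avg_neq0 (x y : P) v : ([~ x, y] = z ^+ 2)%g -> v != 0 ->
  exists b : 'I_d,
    \sum_(a < d) pauli_op (x ^+ a)%g (pauli_op (y ^+ b)%g v) != 0.
Proof.
move=> xy v0; apply/existsP; apply: contraR v0.
rewrite negb_exists => /forallP S0.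
(* sum_b y^-b (sum_a x^a) y^b = sum_a (sum_b xi^(ab)) x^a = d *)
have : \sum_(b < d) pauli_op (y ^- b)%g
    (\sum_(a < d) pauli_op (x ^+ a)%g (pauli_op (y ^+ b)%g v)) = 0.
  apply: big1 => b _; have := S0 b; rewrite negbK => /eqP->.
  exact: linear0.
under eq_bigr => b _.
  rewrite pauli_sum.
  under eq_bigr => a _.
    rewrite -!pauliM -mulgA -conjgE conjg_mulR.
    rewrite (commXgc (@pauli_zetaC _ _ _ zetaP n) (@comm_pauli _ _ _ zetaP n)).
    rewrite (commgXc (@pauli_zetaC _ _ _ zetaP n) (@comm_pauli _ _ _ zetaP n)).
    rewrite xy -!expgM pauliM pauli_zetaX pauliZ.
    over.
  over.
rewrite exchange_big /=.
(* Only a = 0 survives: for other a the coefficient is a full geometric sum of xi^a, a d-th root of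
   unity different from 1. *)
rewrite (bigD1 (Ordinal (dim_gt0 zetaP))) //= [X in _ + X]big1 ?addr0; last first.
  move=> a a0; rewrite -scaler_suml.
  have xa : (zeta ^+ 2) ^+ a - 1 != 0.
    rewrite subr_eq0 (xi_eq1 zetaP); apply: contra a0 => da.
    by apply/eqP/val_inj/eqP; rewrite /= -(modn_small (ltn_ord a)).
  have := subrX1 ((zeta ^+ 2) ^+ a) d.
  rewrite (exprAC (zeta ^+ 2) a d) (xi_d zetaP) expr1n subrr => /esym/eqP.
  rewrite mulf_eq0 (negPf xa) /= => /eqP S.
  rewrite -[RHS](scale0r (pauli_op (x ^+ a)%g v)) -[in RHS]S.
  congr (_ *: _); apply: eq_bigr => b _; rewrite -!exprM.
  by rewrite mulnAC mulnA.
rewrite (eq_bigr (fun=> v)); last first.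
  by move=> b _; rewrite /= !muln0 scale1r id_lfunE.
rewrite big_const_ord iter_addr_0 => /eqP; rewrite -scaler_nat scaler_eq0.
by rewrite pnatr_eq0 gtn_eqF ?(dim_gt0 zetaP).
Qed.

(** The [h i] are treated one at a time. Shifting by powers of [y r] and averaging over [h r] keep
    the vector fixed by the earlier [h i], which commute with both. *)
Lemma exists_fixed_vector (h y : nat -> P) :
    (forall i j, (i < n)%N -> (j < n)%N -> commute (h i) (h j)) ->
    dual z (fun i : 'I_n => h i) (fun i : 'I_n => y i) ->
    (forall i, (i < n)%N -> h i ^+ d = 1)%g ->
  exists2 w : V, hdot w w = 1 & forall i, (i < n)%N -> pauli_op (h i) w = w.
Proof.
move=> hh hy hd.
suff [w w0 wh] : exists2 w : V, w != 0
    & forall i, (i < n)%N -> pauli_op (h i) w = w.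
  have N0 : sqrtC (hdot w w) != 0 by rewrite sqrtC_eq0 hdot_eq0.
  exists ((sqrtC (hdot w w))^-1 *: w) => [|i ik]; last by rewrite pauliZ wh.
  rewrite hdotZ -normCK normfV ger0_norm ?sqrtC_ge0 ?hdot_ge0 //.
  by rewrite exprVn sqrtCK mulVf // hdot_eq0.
suff F r : (r <= n)%N -> exists2 w : V, w != 0
    & forall i, (i < r)%N -> pauli_op (h i) w = w by exact: F.
elim: r => [_|r IH rn].
  exists [ffun=> 1] => //; apply/negP => /eqP/ffunP/(_ (index0 zetaP n)).
  by rewrite !ffunE => /eqP; rewrite oner_eq0.
have [w w0 wh] := IH (ltnW rn).
have hry : [~ h r, y r]%g = (z ^+ 2)%g.
  by have := hy (Ordinal rn) (Ordinal rn); rewrite eqxx expg1.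
have [b b0] := pauli_avg_neq0 hry w0.
exists (\sum_(a < d) pauli_op (h r ^+ a)%g (pauli_op (y r ^+ b)%g w)) => //.
move=> i; rewrite ltnS leq_eqVlt => /orP[/eqP->|ir].
  exact/pauli_sum_pow/hd.
have iN := ltn_trans ir rn.
have hir : commute (h i) (y r).
  apply/commgP/eqP; have := hy (Ordinal iN) (Ordinal rn).
  by rewrite (_ : (_ == _) = false) //; apply/negbTE; rewrite -val_eqE /= ltn_eqF.
rewrite pauli_sum; apply: eq_bigr => a _.
rewrite -!pauliM -!mulgA.
have -> : (h i * (h r ^+ a * y r ^+ b) = h r ^+ a * y r ^+ b * h i)%g.
  exact/commuteM/commuteX/hir/commuteX/hh.
by rewrite (pauliM _ (h i)) wh // pauliM.
Qed.

End PauliUnitary.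

(** * The isometry defined by m dual pairs and a fixed vector *)

Section Encoder.

Variables (C : numClosedFieldType) (d : nat) (zeta : C).
Hypothesis zetaP : (dbar d).-primitive_root zeta.
Variables n m : nat.
Local Notation P := (pauli zetaP n).
Local Notation V := (qudits C d n).
Local Notation V' := (qudits C d m).
Local Notation J := {ffun 'I_m -> 'I_d}.
Local Notation z := (pauli_zeta zetaP n).

Variables (h y : 'I_m -> P) (w : V).
Hypothesis yC : forall i j, commute (y i) (y j).
Hypothesis hy : dual z h y.
Hypothesis yd : forall i, (y i ^+ d = 1)%g.
Hypothesis hw : forall i, pauli_op (h i) w = w.
Hypothesis w1 : hdot w w = 1.

Definition logical_vec (j : J) : V := pauli_op (prod_pow y (fun i => j i)) w.

Lemma logical_vec_Y r j :
  pauli_op (y r) (logical_vec j) = logical_vec (upd j r (ordS (j r))).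
Proof.
rewrite /logical_vec -pauliM prod_pow_incr //; congr (pauli_op _ w).
apply: eq_bigr => i _; rewrite ffunE; case: eqP => [->|_]; last by rewrite add0n.
by rewrite add1n /= expg_mod.
Qed.

Lemma logical_vec_H r j :
  pauli_op (h r) (logical_vec j) = (zeta ^+ 2) ^+ j r *: logical_vec j.
Proof.
rewrite /logical_vec -pauliM commgC.
rewrite (commg_prod_pow_dual (@pauli_zetaC _ _ _ zetaP n) (@comm_pauli _ _ _ zetaP n) _ _ hy).
rewrite -mulgA -expgM pauliM pauliM pauli_zetaX pauliZ pauliZ hw.
by rewrite exprM.
Qed.

Lemma hdot_logical_vec i j : hdot (logical_vec i) (logical_vec j) = (i == j)%:R.
Proof.
have [->|ij] := eqVneq i j; first by rewrite pauli_unitary.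
have [r /eqP rij] : exists r, i r <> j r.
  apply: boolp.contrapT => nij; case/eqP: ij; apply/ffunP => r.
  by apply: boolp.contrapT => ijr; apply: nij; exists r.
(* The unitary [h r] multiplies this product by xi^(i_r - j_r), which differs from 1. *)
have := pauli_unitary (h r) (logical_vec i) (logical_vec j).
rewrite !logical_vec_H hdotZ => /eqP; rewrite -subr_eq0 -{2}[hdot _ _]mul1r -mulrBl.
rewrite mulf_eq0 => /orP[|/eqP//]; rewrite subr_eq0 => /eqP E.
case/eqP: rij; apply/val_inj/eqP.
rewrite -[val (i r)](modn_small (ltn_ord _)).
rewrite -[val (j r)](modn_small (ltn_ord _)).
rewrite -(eq_prim_root_expr (xi_prim zetaP)).
set a := _ ^+ i r in E *; set b := _ ^+ j r in E *.
have b1 : b^* * b = 1.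
  by rewrite mulrC -normCK /b !normrX (norm_zeta zetaP) !expr1n.
by rewrite -[a]mulr1 -b1 mulrA E mul1r.
Qed.

Definition encode_fun (v : V') : V := \sum_j v j *: logical_vec j.
Definition encode : 'Hom(V', V) := linfun encode_fun.

Lemma encodeE v : encode v = \sum_j v j *: logical_vec j.
Proof.
have lin : linear encode_fun.
  move=> a u v'; rewrite /encode_fun scaler_sumr -big_split; apply: eq_bigr => j _.
  by rewrite !ffunE scalerDl scalerA.
pose F : {linear V' -> V} := HB.pack encode_fun (GRing.isLinear.Build _ _ _ _ _ lin).
exact: (lfunE F v).
Qed.

Lemma encode_isometry u v : hdot (encode u) (encode v) = hdot u v.
Proof.
rewrite !encodeE hdot_suml; apply: eq_bigr => i _; rewrite hdot_sumr.
rewrite (bigD1 i) //= hdot_logical_vec eqxx mulr1 big1 ?addr0 // => j ji.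
by rewrite hdot_logical_vec eq_sym (negPf ji) mulr0.
Qed.

Lemma encode_inj : injective encode.
Proof.
move=> u v /eqP; rewrite -subr_eq0 -linearB -hdot_eq0 encode_isometry hdot_eq0.
by rewrite subr_eq0 => /eqP.
Qed.

Lemma encode_delta j : encode [ffun i => (i == j)%:R] = logical_vec j.
Proof.
rewrite encodeE (bigD1 j) //= ffunE eqxx scale1r big1 ?addr0 // => i /negPf ij.
by rewrite ffunE ij scale0r.
Qed.

Lemma encode_X r v : encode (pauli_op (pX zetaP r) v) = pauli_op (y r) (encode v).
Proof.
rewrite !encodeE pauli_sum.
have upd_bij : injective (fun j : J => upd j r (ordS (j r))).
  apply: (can_inj (g := fun j : J => upd j r (ord_pred (j r)))) => j.
  by rewrite updE ordSK upd_upd upd_id.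
rewrite (reindex_inj upd_bij); apply: eq_bigr => j _.
by rewrite pauliZ logical_vec_Y pX_E updE ordSK upd_upd upd_id.
Qed.

Lemma encode_Z r v : encode (pauli_op (pZ zetaP r) v) = pauli_op (h r) (encode v).
Proof.
rewrite !encodeE pauli_sum; apply: eq_bigr => j _.
by rewrite pauliZ logical_vec_H pZ_E scalerA mulrC.
Qed.

(** The lift is a word in scalars, the [h r] and the [y r], whence the second clause; it later shows
    that the lift centralises [H]. *)
Lemma encode_lift (p : pauli zetaP m) : exists g : P,
  (forall v, encode (pauli_op p v) = pauli_op g (encode v)) /\
  (forall u, (forall r, commute u (h r)) -> (forall r, commute u (y r)) ->
     commute u g).
Proof.
elim/pauli_ind: p => [||r|r|p p' [g [gE gC]] [g' [gE' gC']]].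
- exists 1%g; split=> [v|u _ _]; last exact: commute1.
  by rewrite !pauli1.
- exists z; split=> [v|u _ _]; last exact/commute_sym/pauli_zetaC.
  by rewrite !pauli_zetaE linearZ.
- by exists (y r); split=> [v|u _ uy]; [apply: encode_X|apply: uy].
- by exists (h r); split=> [v|u uh _]; [apply: encode_Z|apply: uh].
exists (g * g')%g; split=> [v|u uh uy]; last first.
  by apply: commuteM; [apply: gC|apply: gC'].
by rewrite !pauliM gE gE'.
Qed.

(** A relation, because operators that differ by an element of the stabiliser implement the same
    [p]. *)
Definition encodes (p : pauli zetaP m) (g : P) :=
  forall v, pauli_op g (encode v) = encode (pauli_op p v).

Lemma encodes1 : encodes 1%g 1%g.
Proof. by move=> v; rewrite !pauli1. Qed.

Lemma encodesM p p' g g' :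
  encodes p g -> encodes p' g' -> encodes (p * p')%g (g * g')%g.
Proof. by move=> pg pg' v; rewrite !pauliM pg' pg. Qed.

Lemma encodesX p g i : encodes p g -> encodes (p ^+ i)%g (g ^+ i)%g.
Proof.
move=> pg; elim: i => [|i IH]; first exact: encodes1.
by rewrite !expgS; apply: encodesM.
Qed.

Lemma encodes_prod_pow (I : finType) (s : I -> P) a :
  (forall i, exists p, encodes p (s i ^+ a i)%g) -> exists p, encodes p (prod_pow s a).
Proof.
move=> sE; rewrite /prod_pow; elim/big_rec: _ => [|i x _ [p px]].
  by exists 1%g; apply: encodes1.
by have [p' px'] := sE i; exists (p' * p)%g; apply: encodesM.
Qed.

Lemma encodes_zeta i : encodes (pauli_zeta zetaP m ^+ i)%g (z ^+ i)%g.
Proof. by move=> v; rewrite !pauli_zetaX linearZ. Qed.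

End Encoder.

(** With as many pairs as qudits, source and target have equal dimension and injectivity
    suffices. *)
Lemma encode_surj (C : numClosedFieldType) d (zeta : C)
    (zetaP : (dbar d).-primitive_root zeta) n (h y : 'I_n -> pauli zetaP n) w :
    dual (pauli_zeta zetaP n) h y ->
    (forall i, pauli_op (h i) w = w) -> hdot w w = 1 ->
  forall v, exists u, v = encode y w u.
Proof.
move=> hy hw w1 v; exists ((encode y w)^-1%VF v).
rewrite limg_lfunVK //.
suff -> : limg (encode y w) = fullv by apply: memvf.
apply/eqP; rewrite eqEdim subvf limg_dim_eq ?leqnn // capfv.
by apply/eqP/lker0P/(encode_inj hy).
Qed.

(** * The code space of H and its logical operators *)

Section StabilizerCode.

Variables (C : numClosedFieldType) (d : nat) (zeta : C).
Hypothesis zetaP : (dbar d).-primitive_root zeta.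
Variables k m : nat.
Local Notation P := (pauli zetaP (k + m)).
Local Notation V := (qudits C d (k + m)).
Local Notation z := (pauli_zeta zetaP (k + m)).

Variables (H : {group P}) (h y : nat -> P) (w : V).
Hypothesis hH : forall i, (i < k)%N -> h i \in H.
Hypothesis Hh : forall x, x \in H -> exists a, x = prod_pow (fun i : 'I_k => h i) a.
Hypothesis Hz : (H :&: <[z]> = 1)%g.
Hypothesis hh : forall i j, (i < k + m)%N -> (j < k + m)%N -> commute (h i) (h j).
Hypothesis yy : forall i j, (i < k + m)%N -> (j < k + m)%N -> commute (y i) (y j).
Hypothesis hy : dual z (fun i : 'I_(k + m) => h i) (fun i : 'I_(k + m) => y i).
Hypothesis hd : forall i, (i < k + m)%N -> (h i ^+ d = 1)%g.
Hypothesis yd : forall i, (y i ^+ d = 1)%g.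
Hypothesis gen : forall x, exists s a b, s \in <[z]>%g /\
  x = (s * (prod_pow (fun i : 'I_(k + m) => h i) a *
        prod_pow (fun i : 'I_(k + m) => y i) b))%g.
Hypothesis hw : forall i, (i < k + m)%N -> pauli_op (h i) w = w.
Hypothesis w1 : hdot w w = 1.

Definition hm (r : 'I_m) := h (rshift k r).
Definition ym (r : 'I_m) := y (rshift k r).
Local Notation W := (encode ym w).

Lemma ymC i j : commute (ym i) (ym j).
Proof. exact: yy. Qed.

Lemma hmy : dual z hm ym.
Proof. by move=> i j; rewrite (hy (rshift k i) (rshift k j)) eq_rshift. Qed.

Lemma ymd i : (ym i ^+ d = 1)%g.
Proof. exact: yd. Qed.

Lemma hmw i : pauli_op (hm i) w = w.
Proof. exact: hw. Qed.

Lemma h_ym i r : (i < k)%N -> commute (h i) (ym r).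
Proof.
move=> ik; apply/commgP/eqP; have := hy (lshift m (Ordinal ik)) (rshift k r).
by rewrite eq_lrshift.
Qed.

Lemma ltn_km i : (i < k)%N -> (i < k + m)%N.
Proof. by move=> ik; rewrite ltn_addr. Qed.

Lemma encode_fixed_h i u : (i < k)%N -> pauli_op (h i) (W u) = W u.
Proof.
move=> ik; rewrite encodeE pauli_sum; apply: eq_bigr => j _; rewrite pauliZ.
congr (_ *: _); rewrite /logical_vec -pauliM.
have -> : (h i * prod_pow ym (fun r => j r) = prod_pow ym (fun r => j r) * h i)%g.
  by rewrite /prod_pow; apply: commute_prod => r _; apply/commuteX/h_ym.
by rewrite pauliM hw // ltn_km.
Qed.

Lemma fixed_by_h v :
  (v \in fixed_by H) <-> (forall i, (i < k)%N -> pauli_op (h i) v = v).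
Proof.
split=> [/fixed_byP vH i ik|vh]; first exact/vH/hH.
apply/fixed_byP => _ /Hh[a ->]; rewrite /prod_pow.
elim/big_rec: _ => [|i x _ xv]; first exact: pauli1.
by apply/pauli_fixedM/xv/pauli_fixedX/vh.
Qed.

Lemma encode_fixed_by u : W u \in fixed_by H.
Proof. by apply/fixed_by_h => i; apply: encode_fixed_h. Qed.

(** In the coordinates given by all k + m pairs, [h i] acts as Z_i, so a fixed vector is supported
    on indices whose first k entries are 0. *)
Lemma fixed_by_encode v : v \in fixed_by H -> exists u, v = W u.
Proof.
move=> /fixed_by_h vh.
have hwn (i : 'I_(k + m)) : pauli_op (h i) w = w by apply: hw.
have [u vE] := encode_surj hy hwn w1 v.
have u0 (i : 'I_k) j : u j != 0 -> j (lshift m i) = 0%N :> nat.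
  move=> uj; have := vh i (ltn_ord i).
  rewrite vE -(encode_Z hy hwn (lshift m i)).
  move=> /(encode_inj hy hwn w1)/ffunP/(_ j).
  rewrite pZ_E -[RHS]mul1r => /(mulIf uj)/eqP; rewrite (xi_eq1 zetaP).
  by rewrite /dvdn modn_small // => /eqP.
suff: v \in limg W by move=> /memv_imgP[u' _ ->]; exists u'.
rewrite vE encodeE; apply: memv_suml => j _.
have [->|uj] := eqVneq (u j) 0; first by rewrite scale0r mem0v.
apply: memvZ; pose j' : {ffun 'I_m -> 'I_d} := [ffun r => j (rshift k r)].
suff -> : logical_vec (fun i : 'I_(k + m) => y i) w j = logical_vec ym w j'.
  by rewrite -encode_delta memv_img // memvf.
congr (pauli_op _ w); rewrite /prod_pow big_split_ord /= big1 ?mul1g => [|i _].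
  by apply: eq_bigr => r _; rewrite ffunE.
by rewrite u0 // expg0.
Qed.

(** The commutator lies in [H] because [g] normalises it, and it is a scalar. *)
Lemma normH_commute g i : g \in 'N(H)%g -> (i < k)%N -> commute g (h i).
Proof.
move=> gN ik; apply/commgP/eqP/set1gP; rewrite -Hz inE; apply/andP; split.
  by rewrite commgEr groupM ?memJ_norm ?groupV ?hH.
by have /cycleP[c ->] := comm_pauli g (h i); rewrite -expgM mem_cycle.
Qed.

Lemma commute_normH g : (forall i, (i < k)%N -> commute g (h i)) -> g \in 'N(H)%g.
Proof.
move=> gh; apply: (subsetP (cent_sub H)); apply/centP => _ /Hh[a ->].
by apply: commute_prod => i _; apply/commuteX/gh.
Qed.

Local Notation encodes := (@encodes C d zeta zetaP (k + m) m ym w).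

(** The exponents are thus determined modulo [d] by commutators, from which divisibility by [d] is
    read off below. *)
Lemma comm_expr s a b (i : 'I_(k + m)) : s \in <[z]>%g ->
  let g := (s * (prod_pow (fun i : 'I_(k + m) => h i) a *
        prod_pow (fun i : 'I_(k + m) => y i) b))%g in
  [~ h i, g]%g = ((z ^+ 2) ^+ b i)%g /\ [~ g, y i]%g = ((z ^+ 2) ^+ a i)%g.
Proof.
have zc := @pauli_zetaC _ _ _ zetaP (k + m); have cp := @comm_pauli _ _ _ zetaP (k + m).
move=> /cycleP[c ->] /=; split.
  rewrite !(commgMc zc cp) (commg_prod_pow_dual zc cp b i hy).
  rewrite (commg_prod_pow1 zc cp) ?mul1g => [|j]; last exact/eqP/commgP/hh.
  rewrite (_ : [~ h i, z ^+ c] = 1)%g ?mul1g //.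
  exact/eqP/commgP/commute_sym/pauli_zetaXC.
rewrite !(commMgc zc cp) (comm_prod_pow_dual zc cp a i hy).
rewrite (comm_prod_pow1 zc cp) ?mulg1 => [|j]; last exact/eqP/commgP/yy.
rewrite (_ : [~ z ^+ c, y i] = 1)%g ?mul1g //.
exact/eqP/commgP/pauli_zetaXC.
Qed.

Lemma normH_expr g : g \in 'N(H)%g -> exists s a b, [/\ s \in <[z]>%g,
  g = (s * (prod_pow (fun i : 'I_(k + m) => h i) a *
        prod_pow (fun i : 'I_(k + m) => y i) b))%g
  & forall i : 'I_k, (d %| b (lshift m i))%N].
Proof.
move=> gN; have [s [a [b [sz gE]]]] := gen g; exists s, a, b; split=> // i.
have [E _] := comm_expr a b (lshift m i) sz.
rewrite -(q_eq1 (@order_zeta2 _ _ _ zetaP (k + m))) -E -gE.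
by apply/commgP/commute_sym/normH_commute; rewrite //= ltn_ord.
Qed.

(** Divisibility by [d] removes the [y i] with [i < k], the only factors with no logical operator at
    hand. *)
Lemma normH_encodes g : g \in 'N(H)%g -> exists p, encodes p g.
Proof.
move=> /normH_expr[s [a [b [/cycleP[c ->] -> bd]]]].
have [p1 p1E] : exists p, encodes p (prod_pow (fun i : 'I_(k + m) => h i) a).
  apply: encodes_prod_pow => i; case: (split_ordP i) => [i' ->|r ->].
    exists (1 ^+ a (lshift m i'))%g; apply: encodesX => u.
    by rewrite pauli1 encode_fixed_h /=.
  exists (pZ zetaP r ^+ a (rshift k r))%g; apply: encodesX => u.
  by rewrite (encode_Z hmy hmw).
have [p2 p2E] : exists p, encodes p (prod_pow (fun i : 'I_(k + m) => y i) b).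
  apply: encodes_prod_pow => i; case: (split_ordP i) => [i' ->|r ->].
    exists 1%g; have /dvdnP[c' ->] := bd i'.
    by rewrite mulnC expgM yd expg1n; apply: encodes1.
  exists (pX zetaP r ^+ b (rshift k r))%g; apply: encodesX => u.
  by rewrite (encode_X w ymC ymd).
exists (pauli_zeta zetaP m ^+ c * (p1 * p2))%g.
exact/encodesM/encodesM/p2E/p1E/encodes_zeta.
Qed.

Lemma encodes_inj p p' g : encodes p g -> encodes p' g -> p = p'.
Proof.
move=> pg p'g; apply: pauli_eq => v; apply: (encode_inj hmy hmw w1).
by rewrite -pg -p'g.
Qed.

Lemma encodesH g : g \in H -> encodes 1%g g.
Proof. by move=> gH u; rewrite pauli1 (fixed_byP _ _ (encode_fixed_by u)). Qed.

Lemma w_encode : exists u, w = W u.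
Proof.
by apply: fixed_by_encode; apply/fixed_by_h => i ik; apply: hw; apply: ltn_km.
Qed.

Lemma w_neq0 : w != 0.
Proof. by rewrite -hdot_eq0 w1 oner_eq0. Qed.

Lemma encodes_scalar i : encodes 1%g (z ^+ i)%g -> (z ^+ i = 1)%g.
Proof.
have [u wE] := w_encode.
move=> /(_ u); rewrite pauli1 -wE pauli_zetaX -[RHS]scale1r => /eqP.
rewrite -subr_eq0 -scalerBl scaler_eq0 (negPf w_neq0) orbF subr_eq0 => zi.
by apply/eqP; rewrite pauli_zetaX_eq1 (prim_order_dvd zetaP).
Qed.

Lemma encodesV p g : encodes p g -> encodes (p^-1)%g (g^-1)%g.
Proof.
move=> pg v; rewrite -[RHS](pauli1 zetaP) -(mulVg g) pauliM pg -pauliM.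
by rewrite mulgV pauli1.
Qed.

(** If [x] encodes some [p], then [g, x] is a scalar acting trivially on a non-zero space, so [g]
    commutes with [x]. For x = [hm r] and [ym r] this reduces [g] to a scalar times an element of
    [H], and that scalar is 1 for the same reason. *)
Lemma encodes1_mem g : g \in 'N(H)%g -> encodes 1%g g -> g \in H.
Proof.
move=> gN g1; have gm x p : encodes p x -> commute g x.
  move=> px; apply/commgP/eqP; have /cycleP[c cE] := comm_pauli g x.
  rewrite cE -expgM; apply: encodes_scalar; rewrite expgM -cE.
  have := encodesM (encodesV g1) (encodesM (encodesV px) (encodesM g1 px)).
  by rewrite mul1g mulVg mulg1 invg1.
have ghm r : commute g (hm r).
  by apply: (gm _ (pZ zetaP r)) => u; rewrite (encode_Z hmy hmw).
have gym r : commute g (ym r).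
  by apply: (gm _ (pX zetaP r)) => u; rewrite (encode_X w ymC ymd).
have [s [a [b [sz gE bd]]]] := normH_expr gN.
have b1 : prod_pow (fun i : 'I_(k + m) => y i) b = 1%g.
  apply: big1 => i _; suff /dvdnP[c ->] : (d %| b i)%N.
    by rewrite mulnC expgM yd expg1n.
  case: (split_ordP i) => [i' ->|r ->]; first exact: bd.
  have [E _] := comm_expr a b (rshift k r) sz.
  rewrite -(q_eq1 (@order_zeta2 _ _ _ zetaP (k + m))) -E -gE.
  exact/commgP/commute_sym/ghm.
have aH : prod_pow (fun i : 'I_(k + m) => h i) a \in H.
  apply: group_prod => i _; case: (split_ordP i) => [i' ->|r ->].
    by apply/groupX/hH; rewrite /= ltn_ord.
  suff /dvdnP[c ->] : (d %| a (rshift k r))%N.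
    by rewrite mulnC expgM hd // expg1n.
  have [_ E] := comm_expr a b (rshift k r) sz.
  rewrite -(q_eq1 (@order_zeta2 _ _ _ zetaP (k + m))) -E -gE.
  exact/commgP/gym.
have s1 : s = 1%g.
  have /cycleP[c sE] := sz; rewrite sE; apply: encodes_scalar; rewrite -sE.
  have -> : s = (g * (prod_pow (fun i : 'I_(k + m) => h i) a)^-1)%g.
    by rewrite gE b1 mulg1 mulgK.
  rewrite -[1%g](mulgV 1%g); apply: encodesM => //.
  exact/encodesV/encodesH.
by rewrite gE b1 s1 mulg1 mul1g.
Qed.

Lemma encodes_surj p : exists2 g, g \in 'N(H)%g & encodes p g.
Proof.
have [g [gE gC]] := encode_lift ymC hmy ymd hmw p.
exists g => //; apply: commute_normH => i ik; apply/commute_sym/gC => r.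
  exact: hh (ltn_km ik) (ltn_ord (rshift k r)).
exact: h_ym.
Qed.

Lemma stabilizer_code_iso :
  exists (U : 'Hom(subvs_of (fixed_by H), qudits C d m))
         (phi : {morphism ('N(H) / H)%g >-> pauli zetaP m}),
    [/\ bijective U,
        forall v w, hdot (U v) (U w) = hdot (vsval v) (vsval w),
        isom ('N(H) / H)%g [set: pauli zetaP m] phi
      & forall x v, x \in ('N(H) / H)%g -> U (quo_act x v) = phi x (U v)].
Proof.
have Winj := encode_inj hmy hmw w1.
(* The partial inverse of [W] is applied only on its image, which is V^H. *)
pose U : 'Hom(subvs_of (fixed_by H), qudits C d m) := (W^-1 \o linfun vsval)%VF.
have WU v : W (U v) = vsval v.
  rewrite comp_lfunE lfunE /= limg_lfunVK //.
  by have [u ->] := fixed_by_encode (subvsP v); rewrite memv_img ?memvf.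
have /boolp.choice[f fE] (g : P) : exists p, g \in 'N(H)%g -> encodes p g.
  have [/normH_encodes[p pg]|gN] := boolP (g \in 'N(H)%g); first by exists p.
  by exists 1%g.
(* The choice is multiplicative because the encoded operator is unique. *)
have fM : {in 'N(H)%g &, {morph f : x y / (x * y)%g}}.
  move=> x1 x2 xN1 xN2; apply: encodes_inj (fE _ (groupM xN1 xN2)) _.
  exact: encodesM (fE _ xN1) (fE _ xN2).
pose F := Morphism fM.
have kerF : ('ker F = H)%g.
  apply/setP=> g; apply/idP/idP => [gK|gH].
    have gN : g \in 'N(H)%g := dom_ker gK.
    by apply: encodes1_mem => //; rewrite -(mker gK); apply: fE.
  have gN := subsetP (normG H) _ gH.
  by apply/kerP => //; apply: encodes_inj (fE _ gN) (encodesH gH).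
have imF : (F @* 'N(H) = setT)%g.
  apply/setP=> p; rewrite inE; apply/morphimP.
  have [g gN pg] := encodes_surj p; exists g => //.
  exact: encodes_inj pg (fE _ gN).
have sK : ('ker (coset H) \subset 'ker F)%g by rewrite ker_coset kerF.
pose phi : {morphism ('N(H) / H)%g >-> pauli zetaP m} :=
  factm_morphism sK (subxx 'N(H)%g).
have phiE g : g \in 'N(H)%g -> phi (coset H g) = f g by exact: factmE.
exists U, phi; split.
- have Uinj : injective U.
    by move=> u v uv; apply: subvs_inj; rewrite -!WU uv.
  exists (fun p => vsproj (fixed_by H) (W p)) => [v|p].
    by rewrite WU vsvalK.
  by apply: Winj; rewrite WU vsprojK // encode_fixed_by.
- by move=> u v; rewrite -!WU (encode_isometry hmy hmw w1).
- apply/isomP; split; last by rewrite morphim_factm.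
  by apply/injm_factmP; rewrite kerF ker_coset.
move=> _ v /morphimP[g gN _ ->]; apply: Winj.
by rewrite WU quo_actE // phiE // -(fE _ gN) WU.
Qed.

End StabilizerCode.

(* The hypothesis on d = 1 only fixes the meaning of the rank over the zero *)
(* ring Z/1, where the trivial group is isomorphic to (Z/1)^k for every k.  *)
Theorem theorem1 (R : realType) (d n k : nat) (zeta : R[i])
    (zetaP : (dbar d).-primitive_root zeta)
    (H : {group pauli zetaP n}) :
  (0 < d)%N -> (0 < n)%N ->
  (d = 1%N -> (k <= n)%N) ->
  abelian H ->
  (H :&: <[pauli_zeta zetaP n]> = 1)%g ->
  H \isog setXn (fun _ : 'I_k => Zp d) ->
  (k <= n)%N /\
  exists (U : 'Hom(subvs_of (fixed_by H), qudits R[i] d (n - k)))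
         (phi : {morphism ('N(H) / H)%g >-> pauli zetaP (n - k)}),
    [/\ bijective U,
        forall v w, hdot (U v) (U w) = hdot (vsval v) (vsval w),
        isom ('N(H) / H)%g [set: pauli zetaP (n - k)] phi
      & forall x v, x \in ('N(H) / H)%g -> U (quo_act x v) = phi x (U v)].
Proof.
move=> _ _ kn1 abH Hz isoH.
have [kn [h [y [hH Hh [hh yy hy] [hd yd] gen]]]] :=
  pauli_symplectic_basis kn1 abH Hz isoH.
have [w w1 hw] := exists_fixed_vector hh hy hd; split=> //.
(* Writing n as k + m splits the indices into those of [H] and those of the logical qudits. *)
move: (n - k)%N (subnKC kn) => m nE; subst n.
exact: (stabilizer_code_iso hH Hh Hz hh yy hy hd yd gen hw w1).
Qed.
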